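(* Let $m,n\ge1$, let $A_i,\widetilde A_i$ ($i=1,\dots,m$) be $n\times n$ complex matrices and let $Q,\widetilde Q$ be $n\times n$ Hermitian positive definite matrices. Let $X$ and $\widetilde X$ be the (unique) Hermitian positive definite solutions of $X-\sum_{i=1}^m A_i^*X^{-1}A_i=Q$ and $\widetilde X-\sum_{i=1}^m\widetilde A_i^*\widetilde X^{-1}\widetilde A_i=\widetilde Q$, respectively. With $\Delta A_i=\widetilde A_i-A_i$, $\Delta Q=\widetilde Q-Q$ and the quantities $l,\zeta,\theta,\epsilon,\sigma$ defined in the context, if $$\sigma<1\quad\text{and}\quad \epsilon<\frac{l(1-\sigma)^2}{\zeta\left(l+l\sigma+2\theta+2\sqrt{(l\sigma+\theta)(\theta+l)}\right)},$$ then $$\|\widetilde X-X\|\le\frac{2l\epsilon}{l(1+\zeta\epsilon-\sigma)+\sqrt{l^2(1+\zeta\epsilon-\sigma)^2-4l\zeta\epsilon(l+\theta)}}.$$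
   Context: $\|\cdot\|$ on matrices is the spectral norm; $\mathcal H^{n\times n}$ and $\mathcal C^{n\times n}$ are the sets of $n\times n$ Hermitian and complex matrices. For every choice of $n\times n$ complex $A_i$ and Hermitian positive definite $Q$, the equation $X-\sum_{i=1}^m A_i^*X^{-1}A_i=Q$ has exactly one Hermitian positive definite solution. Put $B_i=X^{-1}A_i$. Define the linear operator $\mathbf L:\mathcal H^{n\times n}\to\mathcal H^{n\times n}$ by $\mathbf LW=W+\sum_{i=1}^m B_i^*WB_i$; it is invertible. Define $\mathbf P_i:\mathcal C^{n\times n}\to\mathcal H^{n\times n}$ by $\mathbf P_iZ=\mathbf L^{-1}(B_i^*Z+Z^*B_i)$, $i=1,\dots,m$. Operator norms are $$\|\mathbf L^{-1}\|=\max_{W\in\mathcal H^{n\times n},\,\|W\|=1}\|\mathbf L^{-1}W\|,\qquad \|\mathbf P_i\|=\max_{Z\in\mathcal C^{n\times n},\,\|Z\|=1}\|\mathbf P_iZ\|.$$ Set $$l=\|\mathbf L^{-1}\|^{-1},\quad \zeta=\|X^{-1}\|,\quad m_i=\|A_i\|,\quad n_i=\|\mathbf P_i\|,\quad \theta_i=\|B_i\|,\quad \theta=\sum_{i=1}^m\theta_i^2,$$ $$\epsilon=\frac1l\|\Delta Q\|+\sum_{i=1}^m\left(n_i\|\Delta A_i\|+\frac{\zeta}{l}\|\Delta A_i\|^2\right),\qquad \sigma=\frac{\zeta}{l}\sum_{i=1}^m\left((m_i+\|\Delta A_i\|)\zeta+\theta_i\right)\|\Delta A_i\|.$$ *)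

(* Defs.v *)
From HB Require Import structures.
From mathcomp Require Import all_boot all_order all_algebra.
From mathcomp Require Import complex.
From mathcomp Require Import boolp classical_sets functions reals.

Set Implicit Arguments.
Unset Strict Implicit.
Unset Printing Implicit Defensive.

Import Order.TTheory GRing.Theory Num.Theory.
Local Open Scope ring_scope.
Local Open Scope classical_set_scope.
Local Open Scope sesquilinear_scope.

Section MatrixNorms.
Variables (R : realType) (n : nat).

Definition l2norm (x : 'cV[R[i]]_n) : R :=
  Num.sqrt (\sum_i Normc.normc (x i 0) ^+ 2).

(* The spectral norm, as the operator norm subordinate to [l2norm].  For
   0 < n the unit sphere is nonempty and compact, so this [sup] and the one
   in [opnorm] below are maxima. *)
Definition spnorm (A : 'M[R[i]]_n) : R :=
  sup [set l2norm (A *m x) | x in [set x : 'cV[R[i]]_n | l2norm x = 1]].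

Definition hermset : set 'M[R[i]]_n := [set W | W \is hermsymmx].

(* The order on [R[i]] is partial: [0 < z] says that [z] is real and positive. *)
Definition posdef (A : 'M[R[i]]_n) : Prop :=
  hermset A /\
  forall x : 'cV[R[i]]_n, x != 0 -> 0 < (x ^t* *m A *m x) 0 0.

(* The norm of an operator F defined on the subspace D of the matrices, both
   domain and codomain carrying the spectral norm. *)
Definition opnorm (D : set 'M[R[i]]_n) (F : 'M[R[i]]_n -> 'M[R[i]]_n) : R :=
  sup [set spnorm (F W) | W in [set W | D W /\ spnorm W = 1]].

End MatrixNorms.

Arguments hermset {R n}.

Section Equation.
Variables (R : realType) (m n : nat).
Implicit Types (A B : 'I_m -> 'M[R[i]]_n) (Q X W Z : 'M[R[i]]_n).

Definition posdef_solution A Q X : Prop :=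
  posdef X /\ X - \sum_i (A i) ^t* *m invmx X *m A i = Q.

Definition Lop B W : 'M[R[i]]_n := W + \sum_i (B i) ^t* *m W *m B i.

(* The inverse of [Lop B] as an operator on Hermitian matrices: [Linv B W] is a
   Hermitian V with [Lop B V = W] whenever there is one. *)
Definition Linv B : 'M[R[i]]_n -> 'M[R[i]]_n :=
  'pinv_(fun=> 0) hermset (Lop B).

Definition Pop B (i : 'I_m) Z : 'M[R[i]]_n :=
  Linv B ((B i) ^t* *m Z + Z ^t* *m B i).

End Equation.

(* Main.v *)
Require Import Defs.
From HB Require Import structures.
From mathcomp Require Import all_boot all_order all_algebra.
From mathcomp Require Import complex.
From mathcomp Require Import boolp classical_sets functions reals.
From mathcomp Require Import ring lra.

(* Write the perturbed equation for [H = tX - X] as [H = step H], where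
   [step H = L^-1 (rhs H)].  On the ball of radius [s], the smaller root of the
   majorant equation
     [s = eps + sigma s / (1 - zeta s) + theta zeta s^2 / (l (1 - zeta s))],
   i.e. the bound claimed for [|tX - X|], [step] maps the ball into itself, and
   its Lipschitz constant is at most the derivative of the majorant at [s],
   which is below 1 because the discriminant is positive.  So no Brouwer
   fixed point is needed, and not even a limit of matrices: the iterates of
   [step] from 0 solve the perturbed equation up to a residual [O(q^j)], and a
   quantitative form of uniqueness, proved in the Thompson metric, shows that
   they come arbitrarily close to [tX - X]. *)

Set Implicit Arguments.
Unset Strict Implicit.
Unset Printing Implicit Defensive.

Import Order.TTheory GRing.Theory Num.Theory.
Local Open Scope ring_scope.
Local Open Scope classical_set_scope.
Local Open Scope sesquilinear_scope.

(** The solution [tX] is only known to be positive definite. Nothing places it near [X] beforehand,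
    so the contraction of [step] on the ball cannot be applied to it, and the comparison with the
    iterates has to hold on the whole positive definite cone. What is available there is order:
    [W |-> sum_i A_i^* W^-1 A_i] reverses it, and adding a fixed [Q > 0] strictly shrinks ratios of
    quadratic forms. The invertibility of [L] has the same source: [X - sum_i B_i^* X B_i = Q > 0],
    read through quadratic forms. In the majorant, [sigma] gathers the part of the remainder that
    contains both [H] and a coefficient perturbation, and the [theta] term is the part of second
    order in [H]; the denominators [1 - zeta s] come from bounding [(X + H)^-1]. For the Lipschitz
    constant to be exactly the slope at [s], differences of remainders are factored through the
    resolvent identity before norms are taken. *)

Section RealInnerProduct.
Variables (R : realType) (n : nat).
Local Notation C := R[i].
Local Notation rc := (real_complex R).
Implicit Types (A B W : 'M[C]_n) (x y z : 'cV[C]_n) (t : R).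

(** The real part makes the Hermitian product a symmetric bilinear form over the ordered field [R].
    Nothing is lost for [x^* W x] with [W] Hermitian, which is real already. *)
Definition ip x y : R := complex.Re ((x ^t* *m y) 0 0).

Lemma ipC x y : ip x y = ip y x.
Proof.
rewrite /ip !mxE !raddf_sum; apply: eq_bigr => j _; rewrite !mxE.
by case: (x j 0) => a b; case: (y j 0) => c d /=; ring.
Qed.

Lemma ipDr x y z : ip x (y + z) = ip x y + ip x z.
Proof. by rewrite /ip mulmxDr mxE raddfD. Qed.

Lemma ipZr t x y : ip x (rc t *: y) = t * ip x y.
Proof.
rewrite /ip -scalemxAr mxE; case: ((x ^t* *m y) 0 0) => a b /=.
by rewrite mul0r subr0.
Qed.

Lemma trmxCM m p q (A : 'M[C]_(m, p)) (B : 'M[C]_(p, q)) : (A *m B) ^t* = B ^t* *m A ^t*.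
Proof. by rewrite trmx_mul map_mxM. Qed.

Lemma ip_adj A x y : ip (A *m x) y = ip x (A ^t* *m y).
Proof. by rewrite /ip trmxCM mulmxA. Qed.

Lemma ipxx x : ip x x = l2norm x ^+ 2.
Proof.
rewrite /l2norm sqr_sqrtr; last by apply: sumr_ge0 => j _; rewrite sqr_ge0.
rewrite /ip !mxE raddf_sum; apply: eq_bigr => j _; rewrite !mxE.
case: (x j 0) => a b /=; rewrite sqr_sqrtr; first by ring.
by rewrite addr_ge0 ?sqr_ge0.
Qed.
End RealInnerProduct.

Lemma quadratic_discriminant (F : realFieldType) (a b c : F) :
  0 <= a -> 0 <= c -> (forall t, 0 <= a + (t * b + t * b) + t ^+ 2 * c) ->
  b ^+ 2 <= a * c.
Proof.
move=> a0 c0 h; have [c_eq0|c_neq0] := eqVneq c 0.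
  have [->|b_neq0] := eqVneq b 0; first by rewrite c_eq0; nra.
  (* With [c = 0] the expression is affine in [t], and at this [t] it equals -1. *)
  have := h (- (a + 1) / (2 * b)); rewrite c_eq0.
  have -> : - (a + 1) / (2 * b) * b = - (a + 1) / 2 by field.
  by lra.
have cp : 0 < c by rewrite lt_neqAle eq_sym c_neq0.
have := h (- b / c).
have -> : a + (- b / c * b + - b / c * b) + (- b / c) ^+ 2 * c = (a * c - b ^+ 2) / c.
  by field.
by rewrite pmulr_lge0 ?invr_gt0 // subr_ge0.
Qed.

(** * The spectral norm and its control by quadratic forms *)

Section Norms.
Variables (R : realType) (n : nat).
Local Notation C := R[i].
Local Notation rc := (real_complex R).
Implicit Types (A B W : 'M[C]_n) (x y z : 'cV[C]_n) (t K : R).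

Lemma ipDl x y z : ip (x + y) z = ip x z + ip y z.
Proof. by rewrite !(ipC _ z) ipDr. Qed.

Lemma ipZl t x y : ip (rc t *: x) y = t * ip x y.
Proof. by rewrite !(ipC _ y) ipZr. Qed.

Lemma ipNr x y : ip x (- y) = - ip x y.
Proof. by rewrite -scaleN1r -(rmorphN1 rc) ipZr mulN1r. Qed.

Lemma ipNl x y : ip (- x) y = - ip x y.
Proof. by rewrite !(ipC _ y) ipNr. Qed.

Lemma ip0r x : ip x 0 = 0.
Proof. by rewrite -[X in ip x X](scale0r x) -(rmorph0 rc) ipZr mul0r. Qed.

Lemma ip_sumr (I : Type) (r : seq I) (P : pred I) (F : I -> 'cV[C]_n) x :
  ip x (\sum_(i <- r | P i) F i) = \sum_(i <- r | P i) ip x (F i).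
Proof.
by elim/big_rec2: _ => [|i u v _ <-]; rewrite ?ip0r ?ipDr.
Qed.

Lemma ip_herm W x y : W ^t* = W -> ip x (W *m y) = ip y (W *m x).
Proof. by move=> hW; rewrite ipC ip_adj hW. Qed.

Lemma l2norm_ge0 x : 0 <= l2norm x.
Proof. exact: sqrtr_ge0. Qed.

Lemma l2normE x : l2norm x = Num.sqrt (ip x x).
Proof. by rewrite ipxx sqrtr_sqr ger0_norm ?l2norm_ge0. Qed.

Lemma l2normZ (c : C) x : l2norm (c *: x) = Normc.normc c * l2norm x.
Proof.
have -> : Normc.normc c = Num.sqrt (Normc.normc c ^+ 2).
  by rewrite sqrtr_sqr ger0_norm //; case: c => a b; apply: sqrtr_ge0.
rewrite /l2norm -sqrtrM ?sqr_ge0 //; congr Num.sqrt.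
rewrite mulr_sumr; apply: eq_bigr => i _.
by rewrite mxE ComplexField.Normc.normcM exprMn.
Qed.

Lemma l2normZr t x : l2norm (rc t *: x) = `|t| * l2norm x.
Proof. by rewrite l2normZ /= expr0n addr0 sqrtr_sqr. Qed.

Lemma l2norm0 : l2norm (0 : 'cV[C]_n) = 0.
Proof. by rewrite l2normE ip0r sqrtr0. Qed.

Lemma l2norm_eq0 x : l2norm x = 0 -> x = 0.
Proof.
move=> x0; have : l2norm x ^+ 2 = 0 by rewrite x0 expr0n.
rewrite /l2norm sqr_sqrtr; last by apply: sumr_ge0 => j _; rewrite sqr_ge0.
move=> /eqP; rewrite psumr_eq0 => [/allP h|j _]; last exact: sqr_ge0.
apply/matrixP => i j; rewrite ord1 mxE.
have /= := h i (mem_index_enum i); rewrite sqrf_eq0 => /eqP.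
exact: ComplexField.Normc.eq0_normc.
Qed.

Lemma l2norm_gt0 x : x != 0 -> 0 < l2norm x.
Proof.
move=> x0; rewrite lt_neqAle l2norm_ge0 andbT eq_sym.
by apply: contra_neq x0; apply: l2norm_eq0.
Qed.

Lemma form_CauchySchwarz W x y : W ^t* = W -> (forall z, 0 <= ip z (W *m z)) ->
  ip x (W *m y) ^+ 2 <= ip x (W *m x) * ip y (W *m y).
Proof.
move=> hW W0; apply: quadratic_discriminant => // t.
have := W0 (x + rc t *: y).
rewrite mulmxDr -scalemxAr !ipDr !ipDl !ipZr !ipZl (ip_herm y x hW).
by rewrite expr2 -mulrA !addrA.
Qed.

Lemma trmxC1 : (1%:M : 'M[C]_n) ^t* = 1%:M.
Proof. by rewrite trmx1 map_mx1. Qed.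

Lemma ip_CauchySchwarz x y : `|ip x y| <= l2norm x * l2norm y.
Proof.
rewrite -ler_sqr ?nnegrE ?mulr_ge0 ?l2norm_ge0 // real_normK ?num_real //.
rewrite exprMn -!ipxx.
have := @form_CauchySchwarz 1%:M x y trmxC1; rewrite !mul1mx; apply=> z.
by rewrite mul1mx ipxx sqr_ge0.
Qed.

Lemma l2normD x y : l2norm (x + y) <= l2norm x + l2norm y.
Proof.
rewrite -ler_sqr ?nnegrE ?addr_ge0 ?l2norm_ge0 // -ipxx ipDr !ipDl !ipxx.
rewrite (ipC y x).
by have := le_trans (ler_norm _) (ip_CauchySchwarz x y); nra.
Qed.

Lemma l2norm_sum (I : Type) (r : seq I) (P : pred I) (F : I -> 'cV[C]_n) :
  l2norm (\sum_(i <- r | P i) F i) <= \sum_(i <- r | P i) l2norm (F i).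
Proof.
elim/big_rec2: _ => [|i u v _ h]; first by rewrite l2norm0.
by rewrite (le_trans (l2normD _ _)) ?lerD2l.
Qed.

Lemma normc_le_l2norm x i : Normc.normc (x i 0) <= l2norm x.
Proof.
have h0 : 0 <= Normc.normc (x i 0) by case: (x i 0) => a b; apply: sqrtr_ge0.
rewrite -ler_sqr ?nnegrE ?l2norm_ge0 // /l2norm sqr_sqrtr; last first.
  by apply: sumr_ge0 => j _; rewrite sqr_ge0.
by rewrite (bigD1 i) //= lerDl; apply: sumr_ge0 => j _; rewrite sqr_ge0.
Qed.

(** A crude constant is enough: it only shows that the set under the [sup] in [spnorm] is bounded
    above. *)
Lemma l2norm_bounded A : exists K, forall x, l2norm (A *m x) <= K * l2norm x.
Proof.
exists (\sum_j l2norm (col j A)) => x.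
have -> : A *m x = \sum_j x j 0 *: col j A.
  apply/matrixP => i j; rewrite ord1 mxE summxE; apply: eq_bigr => k _.
  by rewrite !mxE mulrC.
rewrite (le_trans (l2norm_sum _ _ _)) // mulr_suml ler_sum // => j _.
by rewrite l2normZ mulrC ler_wpM2l ?l2norm_ge0 ?normc_le_l2norm.
Qed.

Lemma unitize x : x != 0 -> l2norm (rc (l2norm x)^-1 *: x) = 1.
Proof.
move=> /l2norm_gt0 x0; rewrite l2normZr ger0_norm ?invr_ge0 ?ltW //.
by rewrite mulVf ?gt_eqF.
Qed.

Lemma spnorm_ub A x : l2norm (A *m x) <= spnorm A * l2norm x.
Proof.
have [->|x_neq0] := eqVneq x 0; first by rewrite mulmx0 l2norm0 mulr0.
have x0 := l2norm_gt0 x_neq0.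
have : l2norm (A *m (rc (l2norm x)^-1 *: x)) <= spnorm A.
  apply: ub_le_sup; last by exists (rc (l2norm x)^-1 *: x) => //=; apply: unitize.
  have [K hK] := l2norm_bounded A; exists K => _ [y /= y1 <-].
  by rewrite (le_trans (hK _)) // y1 mulr1.
rewrite -scalemxAr l2normZr ger0_norm ?invr_ge0 ?l2norm_ge0 //.
by rewrite ler_pdivrMl // mulrC.
Qed.

(** The condition [0 <= K] covers [n = 0], where the unit sphere is empty and the [sup] is 0. *)
Lemma spnorm_le A K : 0 <= K -> (forall x, l2norm (A *m x) <= K * l2norm x) ->
  spnorm A <= K.
Proof.
move=> K0 h; rewrite /spnorm; set S := image _ _.
have [->|/set0P Sn0] := eqVneq S set0; first by rewrite sup0.
by apply: ge_sup => // _ [x /= x1 <-]; rewrite (le_trans (h x)) // x1 mulr1.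
Qed.

Lemma spnorm_ge0 A : 0 <= spnorm A.
Proof.
rewrite /spnorm; set S := image _ _.
have [->|/set0P [_ [x /= x1 _]]] := eqVneq S set0; first by rewrite sup0.
have := le_trans (l2norm_ge0 _) (spnorm_ub A x).
by rewrite x1 mulr1.
Qed.

Lemma spnorm0 : spnorm (0 : 'M[C]_n) = 0.
Proof.
by apply/le_anti; rewrite spnorm_ge0 spnorm_le // => x; rewrite mul0mx l2norm0 mul0r.
Qed.

Lemma spnormD A B : spnorm (A + B) <= spnorm A + spnorm B.
Proof.
apply: spnorm_le => [|x]; first by rewrite addr_ge0 ?spnorm_ge0.
by rewrite mulmxDl (le_trans (l2normD _ _)) // mulrDl lerD ?spnorm_ub.
Qed.

Lemma spnorm_sum (I : Type) (r : seq I) (P : pred I) (F : I -> 'M[C]_n) :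
  spnorm (\sum_(i <- r | P i) F i) <= \sum_(i <- r | P i) spnorm (F i).
Proof.
elim/big_rec2: _ => [|i u v _ h]; first by rewrite spnorm0.
by rewrite (le_trans (spnormD _ _)) ?lerD2l.
Qed.

Lemma spnormZ t A : spnorm (rc t *: A) = `|t| * spnorm A.
Proof.
have le s B : spnorm (rc s *: B) <= `|s| * spnorm B.
  apply: spnorm_le => [|x]; first by rewrite mulr_ge0 ?spnorm_ge0.
  by rewrite -scalemxAl l2normZr -mulrA ler_wpM2l ?spnorm_ub.
have [->|t0] := eqVneq t 0; first by rewrite rmorph0 scale0r spnorm0 normr0 mul0r.
apply/le_anti; rewrite le /=.
have := le t^-1 (rc t *: A); rewrite scalerA -rmorphM mulVf // rmorph1 scale1r.
by rewrite normfV ler_pdivlMl ?normr_gt0.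
Qed.

Lemma spnormN A : spnorm (- A) = spnorm A.
Proof. by rewrite -scaleN1r -(rmorphN1 rc) spnormZ normrN1 mul1r. Qed.

Lemma spnormM A B : spnorm (A *m B) <= spnorm A * spnorm B.
Proof.
apply: spnorm_le => [|x]; first by rewrite mulr_ge0 ?spnorm_ge0.
by rewrite -mulmxA (le_trans (spnorm_ub _ _)) // -mulrA ler_wpM2l ?spnorm_ge0 ?spnorm_ub.
Qed.

Lemma spnorm_eq0 A : spnorm A = 0 -> A = 0.
Proof.
move=> A0; apply/matrixP => i j; rewrite mxE.
have : A *m delta_mx j 0 = 0 :> 'cV_n.
  apply: l2norm_eq0; apply/le_anti; rewrite l2norm_ge0 andbT.
  by rewrite (le_trans (spnorm_ub _ _)) // A0 mul0r.
by move=> /matrixP/(_ i 0); rewrite -colE !mxE.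
Qed.

Lemma spnorm1_gt0 : (0 < n)%N -> 0 < spnorm (1%:M : 'M[C]_n).
Proof.
move=> hn; rewrite lt_neqAle spnorm_ge0 andbT eq_sym; apply/eqP => /spnorm_eq0.
move=> /matrixP/(_ (Ordinal hn) (Ordinal hn)).
by rewrite !mxE eqxx => /eqP; rewrite oner_eq0.
Qed.

Lemma exists_neq0 : (0 < n)%N -> exists x : 'cV[C]_n, x != 0.
Proof.
move=> hn; exists (const_mx 1); apply/negP => /eqP/matrixP/(_ (Ordinal hn) 0).
by rewrite !mxE => /eqP; rewrite oner_eq0.
Qed.

(** From [|B^* x|^2 = (x, B B^* x) <= |x| |B| |B^* x|] one inequality follows for every [B]; the
    other is the same one at [B^*]. *)
Lemma spnorm_adj A : spnorm (A ^t*) = spnorm A.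
Proof.
have le B : spnorm (B ^t*) <= spnorm B.
  apply: spnorm_le => [|x]; first exact: spnorm_ge0.
  have [->|y0] := eqVneq (B ^t* *m x) 0.
    by rewrite l2norm0 mulr_ge0 ?spnorm_ge0 ?l2norm_ge0.
  rewrite -(ler_pM2r (l2norm_gt0 y0)) -expr2 -ipxx ip_adj trmxCK.
  rewrite (le_trans (ler_norm _)) // (le_trans (ip_CauchySchwarz _ _)) //.
  by rewrite mulrC (mulrAC _ (l2norm x)) ler_wpM2r ?l2norm_ge0 ?spnorm_ub.
apply/eqP; rewrite eq_le; apply/andP; split; first exact: le.
by rewrite -[X in spnorm X <= _]trmxCK le.
Qed.

Lemma ip_le_spnorm A x : `|ip x (A *m x)| <= spnorm A * l2norm x ^+ 2.
Proof.
rewrite (le_trans (ip_CauchySchwarz _ _)) // expr2 mulrCA.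
by rewrite ler_wpM2l ?l2norm_ge0 ?spnorm_ub.
Qed.

Lemma parallelogram x y :
  l2norm (x + y) ^+ 2 + l2norm (x - y) ^+ 2 = 2 * (l2norm x ^+ 2 + l2norm y ^+ 2).
Proof.
rewrite -!ipxx !ipDl !ipDr !ipNl !ipNr (ipC y x).
by move: (ip x x) (ip x y) (ip y y) => p q r; ring.
Qed.

Lemma polarization W x y : W ^t* = W ->
  ip (x + y) (W *m (x + y)) - ip (x - y) (W *m (x - y)) = 4 * ip x (W *m y).
Proof.
move=> hW; rewrite !mulmxDr mulmxN !ipDl !ipDr !ipNl !ipNr (ip_herm y x hW).
by move: (ip x (W *m x)) (ip x (W *m y)) (ip y (W *m y)) => p q r; ring.
Qed.

(** For a Hermitian matrix the numerical radius bounds the norm. This is the passage from order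
    inequalities between quadratic forms back to norm bounds. *)
Lemma spnorm_herm_le W K : W ^t* = W -> 0 <= K ->
  (forall x, `|ip x (W *m x)| <= K * l2norm x ^+ 2) -> spnorm W <= K.
Proof.
move=> hW K0 hK; apply: spnorm_le => // x.
have [->|x_neq0] := eqVneq x 0; first by rewrite mulmx0 l2norm0 mulr0.
have [->|y_neq0] := eqVneq (W *m x) 0; first by rewrite l2norm0 mulr_ge0 ?l2norm_ge0.
have := l2norm_gt0 y_neq0; have := l2norm_gt0 x_neq0.
(* polarization at two vectors of the same length *)
pose u := rc (l2norm x) *: (W *m x); pose v := rc (l2norm (W *m x)) *: x.
have /ler_normlP[_ k1] := hK (u + v); have /ler_normlP[k2 _] := hK (u - v).
have := lerD k1 k2; rewrite polarization // -mulrDr parallelogram.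
rewrite -scalemxAr ipZr ipZl ipxx !l2normZr !ger0_norm ?l2norm_ge0 //.
move: (l2norm x) (l2norm (W *m x)) => a b h a0 b0.
have p : 0 < a * b ^+ 2 by rewrite mulr_gt0 ?exprn_gt0.
rewrite -(ler_pM2l p) -(ler_pM2l (ltr0Sn R 3)).
by move: h; congr (_ <= _); ring.
Qed.

End Norms.

(** * Hermitian and positive definite matrices, their inverses and resolvents *)

Section PositiveDefinite.
Variables (R : realType) (n : nat).
Local Notation C := R[i].
Local Notation rc := (real_complex R).
Implicit Types (A B W X H Q : 'M[C]_n) (x y z : 'cV[C]_n) (t K : R).

Lemma hermsetE W : hermset W = (W ^t* = W).
Proof.
rewrite /hermset /=; apply/propext; split => [/is_hermitianmxP|h].
  by rewrite expr0 scale1r.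
by apply/is_hermitianmxP; rewrite expr0 scale1r.
Qed.

Lemma hermsetD A B : hermset A -> hermset B -> hermset (A + B).
Proof. by rewrite !hermsetE linearD /= map_mxD => -> ->. Qed.

Lemma hermsetN A : hermset A -> hermset (- A).
Proof. by rewrite !hermsetE linearN /= map_mxN => ->. Qed.

Lemma hermsetB A B : hermset A -> hermset B -> hermset (A - B).
Proof. by move=> hA /hermsetN; apply: hermsetD. Qed.

Lemma trmxCZ t A : (rc t *: A) ^t* = rc t *: A ^t*.
Proof.
apply/matrixP => i j; rewrite !mxE rmorphM /=; congr (_ * _).
by rewrite -[LHS]/(conjc (rc t)) conjc_real.
Qed.

Lemma hermsetZ t A : hermset A -> hermset (rc t *: A).
Proof. by rewrite !hermsetE trmxCZ => ->. Qed.

Lemma hermset0 : hermset (0 : 'M[C]_n).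
Proof. by rewrite hermsetE linear0 map_mx0. Qed.

Lemma hermset_sum (I : Type) (r : seq I) (P : pred I) (F : I -> 'M[C]_n) :
  (forall i, P i -> hermset (F i)) -> hermset (\sum_(i <- r | P i) F i).
Proof. by move=> h; apply: (big_ind _ hermset0 hermsetD h). Qed.

Lemma hermset_conj A W : hermset W -> hermset (A ^t* *m W *m A).
Proof. by rewrite !hermsetE !trmxCM trmxCK mulmxA => ->. Qed.

Lemma hermset_symM A B : hermset (A ^t* *m B + B ^t* *m A).
Proof. by rewrite hermsetE linearD /= map_mxD !trmxCM !trmxCK addrC. Qed.

Lemma posdef_form W x : posdef W -> x != 0 -> 0 < ip x (W *m x).
Proof.
case=> _ h /h; rewrite -mulmxA ltcE => /andP[_]; by rewrite raddf0.
Qed.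

Lemma posdef_form_ge0 W x : posdef W -> 0 <= ip x (W *m x).
Proof.
move=> hW; have [->|x0] := eqVneq x 0; first by rewrite mulmx0 ip0r.
exact/ltW/posdef_form.
Qed.

Lemma posdef_adj W : posdef W -> W ^t* = W.
Proof. by case; rewrite hermsetE. Qed.

Lemma ip_conj A W x : ip x (A ^t* *m W *m A *m x) = ip (A *m x) (W *m (A *m x)).
Proof. by rewrite -!mulmxA -ip_adj. Qed.

(** The order on complex numbers also asks for a zero imaginary part; it vanishes because the 1 by 1
    matrix [x^* W x] is its own adjoint. *)
Lemma posdefP W : hermset W -> (forall x, x != 0 -> 0 < ip x (W *m x)) -> posdef W.
Proof.
move=> hW h; split => // x /h; rewrite /ip mulmxA ltcE raddf0 => ->.
rewrite andbT; apply/eqP.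
have : (x ^t* *m W *m x) ^t* = x ^t* *m W *m x.
  by rewrite !trmxCM trmxCK mulmxA; move: hW; rewrite hermsetE => ->.
move=> /matrixP/(_ 0 0); rewrite !mxE.
move: (\sum_j _) => -[a b] [] /= hb; lra.
Qed.

Lemma ker0_unitmx A : (forall x, A *m x = 0 -> x = 0) -> A \in unitmx.
Proof.
move=> h; rewrite -unitmx_tr -row_free_unit -kermx_eq0; apply/eqP/row_matrixP => i.
rewrite row0; apply: trmx_inj; rewrite trmx0; apply: h.
apply: trmx_inj; rewrite trmx_mul trmxK trmx0.
by apply/sub_kermxP; apply: row_sub.
Qed.

Lemma posdef_unitmx W : posdef W -> W \in unitmx.
Proof.
move=> hW; apply: ker0_unitmx => x Wx; apply/eqP/contraT => /(posdef_form hW).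
by rewrite Wx ip0r ltxx.
Qed.

Lemma trmxC_inv W : (invmx W) ^t* = invmx (W ^t*).
Proof. by rewrite trmx_inv map_invmx. Qed.

Lemma hermset_inv W : hermset W -> hermset (invmx W).
Proof. by rewrite !hermsetE trmxC_inv => ->. Qed.

Lemma posdef_inv W : posdef W -> posdef (invmx W).
Proof.
move=> hW; have Wu := posdef_unitmx hW.
apply: posdefP; first by apply: hermset_inv; case: hW.
move=> x x0; have -> : ip x (invmx W *m x) = ip (invmx W *m x) (W *m (invmx W *m x)).
  by rewrite mulKVmx // ipC.
apply: posdef_form => //; apply: contra_neq x0 => h.
by rewrite -(mulKVmx Wu x) h mulmx0.
Qed.

Lemma posdef_inv_gt0 W : (0 < n)%N -> posdef W -> 0 < spnorm (invmx W).
Proof.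
move=> n0 hW; rewrite lt_neqAle spnorm_ge0 andbT eq_sym; apply/eqP => /spnorm_eq0 h.
have : invmx W \in unitmx by rewrite unitmx_inv posdef_unitmx.
rewrite h; case: n n0 {W hW h} => // p _; by rewrite unitr0.
Qed.

(** The smallest-eigenvalue bound without spectral theory: Cauchy-Schwarz for the form of [W] at [x]
    and [W^-1 x] gives [|x|^4 <= (x, W x) (x, W^-1 x)], and the last factor is at most
    [|W^-1| |x|^2]. *)
Lemma posdef_lower W x : posdef W ->
  l2norm x ^+ 2 <= spnorm (invmx W) * ip x (W *m x).
Proof.
move=> hW; have [->|x0] := eqVneq x 0; first by rewrite mulmx0 ip0r l2norm0 mulr0 expr0n.
have Wu := posdef_unitmx hW.
have := form_CauchySchwarz x (invmx W *m x) (posdef_adj hW) (fun z => posdef_form_ge0 z hW).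
rewrite mulKVmx // (ipC (invmx W *m x)) ipxx => h1.
have xp : 0 < l2norm x ^+ 2 by rewrite exprn_gt0 ?l2norm_gt0.
rewrite -(ler_pM2l xp) -expr2 (le_trans h1) //.
have /ler_normlP[_ h2] := ip_le_spnorm (invmx W) x.
by rewrite mulrC (mulrCA _ (spnorm _)) mulrA ler_wpM2r ?posdef_form_ge0 // mulrC.
Qed.

(* Cauchy-Schwarz for [Y]: with [y = T^-1 x],
   [(y, T y)^2 = (y, Y Y^-1 x)^2 <= (y, Y y) (x, Y^-1 x)]. *)
Lemma posdef_inv_antitone Y T t x : posdef Y -> posdef T ->
  (forall z, ip z (Y *m z) <= t * ip z (T *m z)) ->
  ip x (invmx T *m x) <= t * ip x (invmx Y *m x).
Proof.
move=> hY hT h; have [->|x0] := eqVneq x 0; first by rewrite !mulmx0 ip0r mulr0.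
have Yu := posdef_unitmx hY; have Tu := posdef_unitmx hT.
have a0 := posdef_form (posdef_inv hT) x0.
have b0 := posdef_form_ge0 x (posdef_inv hY).
have : exists y, y = invmx T *m x by exists (invmx T *m x).
have : exists z, z = invmx Y *m x by exists (invmx Y *m x).
move=> [z zE] [y yE]; rewrite -zE -yE in a0 b0 *.
have Yz : Y *m z = x by rewrite zE (mulKVmx Yu).
have Ty : T *m y = x by rewrite yE (mulKVmx Tu).
have := form_CauchySchwarz y z (posdef_adj hY) (fun z => posdef_form_ge0 z hY).
rewrite Yz (ipC z x) (ipC y x) => h1.
have := h y; rewrite Ty (ipC y x) => h2.
rewrite -(ler_pM2l a0) -expr2; apply: (le_trans h1).
by rewrite mulrCA mulrA; apply: ler_wpM2r.
Qed.

Lemma posdef_add X H : posdef X -> hermset H -> spnorm (invmx X) * spnorm H < 1 ->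
  posdef (X + H).
Proof.
move=> hX hH h; apply: posdefP; first exact: hermsetD (proj1 hX) hH.
move=> x x0; rewrite mulmxDl ipDr.
have h1 := posdef_lower x hX; have /ler_normlP[h2 _] := ip_le_spnorm H x.
have := posdef_form hX x0; have := spnorm_ge0 H.
move: h h1 h2; move: (ip x (X *m x)) (ip x (H *m x)) (l2norm x ^+ 2).
move: (spnorm (invmx X)) (spnorm H) => z s a b c h h1 h2 s0 a0.
have : s * c <= s * (z * a) by rewrite ler_wpM2l.
have : z * s * a < 1 * a by rewrite ltr_pM2r.
by rewrite (mulrC z) mulrA; lra.
Qed.

Lemma invmxD X H : X \in unitmx -> X + H \in unitmx ->
  invmx (X + H) = invmx X - invmx X *m H *m invmx (X + H).
Proof.
move=> Xu Yu; apply: (canRL (addrK _)); apply: (can_inj (mulKmx Xu)).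
by rewrite mulmxDr !mulmxA mulmxV // mul1mx -mulmxDl mulmxV.
Qed.

(** The Neumann-series bound without the series: [|B| <= |A| + |A| s |B|], and the last term is
    absorbed on the left. *)
Lemma spnorm_resolvent A B H s : B = A - A *m H *m B -> spnorm H <= s ->
  spnorm A * s < 1 -> spnorm B <= spnorm A / (1 - spnorm A * s).
Proof.
move=> BE hs h; have h1 : spnorm B <= spnorm A + spnorm A * s * spnorm B.
  rewrite {1}BE; apply: le_trans (spnormD _ _) _; rewrite spnormN lerD2l.
  apply: le_trans (spnormM _ _) _; apply: ler_wpM2r; first exact: spnorm_ge0.
  by apply: le_trans (spnormM _ _) _; apply: ler_wpM2l => //; exact: spnorm_ge0.
move: h h1; move: (spnorm A) (spnorm B) => a b h h1.
by rewrite ler_pdivlMr ?subr_gt0 //; lra.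
Qed.

Lemma spnorm_invD X H s : posdef X -> hermset H -> spnorm H <= s ->
  spnorm (invmx X) * s < 1 ->
  spnorm (invmx (X + H)) <= spnorm (invmx X) / (1 - spnorm (invmx X) * s).
Proof.
move=> hX hH hs h; apply: (spnorm_resolvent (H := H)) => //.
apply: invmxD; first exact: posdef_unitmx.
apply/posdef_unitmx/(posdef_add hX hH)/(le_lt_trans _ h).
by apply: ler_wpM2l => //; exact: spnorm_ge0.
Qed.

End PositiveDefinite.

(** Minimality of [v] replaces a maximizer of [f / g]: any inequality [f <= w * g] deduced from
    [f <= v * g] returns [v <= w], with no compactness argument. Both contraction arguments below
    rest on it. *)
Lemma least_ratio (R : realType) (I : Type) (f g : I -> R) (K : R) (i0 : I) :
  (forall i, 0 < g i) -> (forall i, f i <= K * g i) ->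
  exists2 v, (forall i, f i <= v * g i) &
    forall w, (forall i, f i <= w * g i) -> v <= w.
Proof.
move=> g0 fK; pose S := [set f i / g i | i in [set: I]].
have Sub w : (forall i, f i <= w * g i) -> ubound S w.
  by move=> h _ [i _ <-]; rewrite ler_pdivrMr.
exists (sup S) => [i|w /Sub h].
  by rewrite -ler_pdivrMr //; apply: ub_le_sup; [exists K; apply: Sub|exists i].
by apply: ge_sup => //; exists (f i0 / g i0), i0.
Qed.

Lemma linear_inj_surj (F : fieldType) (n : nat) (f : 'M[F]_n -> 'M[F]_n) :
  linear f -> (forall V, f V = 0 -> V = 0) -> forall W, exists V, f V = W.
Proof.
move=> lf f0 W.
pose g : {linear 'M[F]_n -> 'M[F]_n} :=
  HB.pack f (GRing.isLinear.Build F 'M[F]_n 'M[F]_n *:%R f lf).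
have gu : lin_mx g \in unitmx.
  rewrite -row_free_unit -kermx_eq0; apply/eqP/row_matrixP => i; rewrite row0.
  have /sub_kermxP := row_sub i (kermx (lin_mx g)).
  rewrite -[row i _]vec_mxK mul_vec_lin => /(canRL mxvecK); rewrite linear0.
  by move=> /f0 ->; rewrite linear0.
exists (vec_mx (mxvec W *m invmx (lin_mx g))); apply: (can_inj mxvecK).
by rewrite -[LHS]/(mxvec (g _)) -mul_vec_lin vec_mxK mulmxKV.
Qed.

(** * Invertibility of [L] on Hermitian matrices *)

Section LinearOperator.
Variables (R : realType) (m n : nat) (hn : (0 < n)%N).
Local Notation C := R[i].
Local Notation rc := (real_complex R).
Variable B : 'I_m -> 'M[C]_n.
Implicit Types (V W X Q : 'M[C]_n).

Lemma Lop_linear : linear (Lop B).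
Proof.
move=> c V W; rewrite /Lop scalerDr addrACA; congr (_ + _).
rewrite scaler_sumr -big_split; apply: eq_bigr => i _ /=.
by rewrite mulmxDr mulmxDl -scalemxAr -scalemxAl.
Qed.

Lemma Lop0 : Lop B 0 = 0.
Proof. by rewrite /Lop big1 ?add0r // => i _; rewrite mulmx0 mul0mx. Qed.

Lemma LopD V W : Lop B (V + W) = Lop B V + Lop B W.
Proof. by rewrite -[V in LHS]scale1r Lop_linear scale1r. Qed.

Lemma LopZ (c : C) V : Lop B (c *: V) = c *: Lop B V.
Proof. by rewrite -[c *: V]addr0 Lop_linear Lop0 addr0. Qed.

Lemma LopN V : Lop B (- V) = - Lop B V.
Proof. by rewrite -scaleN1r LopZ scaleN1r. Qed.

Lemma LopB V W : Lop B (V - W) = Lop B V - Lop B W.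
Proof. by rewrite LopD LopN. Qed.

Lemma Lop_adj V : (Lop B V) ^t* = Lop B (V ^t*).
Proof.
rewrite /Lop linearD /= map_mxD linear_sum /= map_mx_sum; congr (_ + _).
by apply: eq_bigr => i _; rewrite !trmxCM trmxCK mulmxA.
Qed.

Lemma Lop_herm V : hermset V -> hermset (Lop B V).
Proof. by rewrite !hermsetE Lop_adj => ->. Qed.

Lemma spnorm_Lop V : spnorm (Lop B V) <= (1 + \sum_i spnorm (B i) ^+ 2) * spnorm V.
Proof.
apply: le_trans (spnormD _ _) _; rewrite mulrDl mul1r lerD2l mulr_suml.
apply: le_trans (spnorm_sum _ _ _) _; apply: ler_sum => i _.
apply: le_trans (spnormM _ _) _; rewrite expr2 -mulrA [leRHS]mulrC.
apply: ler_wpM2r; first exact: spnorm_ge0.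
by apply: le_trans (spnormM _ _) _; rewrite spnorm_adj mulrC.
Qed.

Variables (X Q : 'M[C]_n).
Hypotheses (hX : posdef X) (hQ : posdef Q).
Hypothesis eqX : X - \sum_i (B i) ^t* *m X *m B i = Q.

(* The operator [V |-> sum_i B_i^* V B_i] maps [X] to [X - Q], hence contracts
   the order-unit norm of [X]. *)
Lemma Lop_bounded_below :
  exists2 K, 0 <= K & forall V, hermset V -> spnorm V <= K * spnorm (Lop B V).
Proof.
(* In the order of quadratic forms [1 <= z X] and [X <= k Q]; so [k] measures how strictly
   [sum_i B_i^* X B_i = X - Q] lies below [X]. *)
pose z := spnorm (invmx X); pose k := spnorm X * spnorm (invmx Q).
have z0 : 0 <= z := spnorm_ge0 _.
have k0 : 0 <= k by rewrite mulr_ge0 ?spnorm_ge0.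
exists (k * z * spnorm X) => [|V hV]; first by rewrite !mulr_ge0 ?spnorm_ge0.
pose q W x := ip x (W *m x).
have Xz x : l2norm x ^+ 2 <= z * q X x := posdef_lower x hX.
have Xup x : q X x <= spnorm X * l2norm x ^+ 2.
  exact: le_trans (ler_norm _) (ip_le_spnorm X x).
have XQ x : q X x <= k * q Q x.
  apply: le_trans (Xup x) _; rewrite -mulrA.
  by apply: ler_wpM2l; [exact: spnorm_ge0|exact: posdef_lower].
have qV W x : `|q W x| <= spnorm W * z * q X x.
  apply: le_trans (ip_le_spnorm _ _) _; rewrite -mulrA.
  by apply: ler_wpM2l; [exact: spnorm_ge0|exact: Xz].
clearbody z k.
have [x1 x1_neq0] := exists_neq0 R hn.
have [v hv vmin] := @least_ratio R {x : 'cV[C]_n | x != 0}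
  (fun x => `|q V (sval x)|) (fun x => q X (sval x)) (spnorm V * z)
  (exist _ x1 x1_neq0) (fun x => posdef_form hX (svalP x)) (fun x => qV V (sval x)).
have hv' x : `|q V x| <= v * q X x.
  have [->|x0] := eqVneq x 0; first by rewrite /q !mulmx0 !ip0r normr0 mulr0.
  exact: hv (exist _ x x0).
pose w := spnorm (Lop B V).
(* Write [V = L V - sum_i B_i^* V B_i] and use [|V| <= v X] at each [B_i x]; the sum of the forms of
   [X] at these vectors is that of [X - Q] at [x]. *)
have step x : `|q V x| <= w * z * q X x + v * (q X x - q Q x).
  have -> : q V x = q (Lop B V) x - \sum_i q V (B i *m x).
    rewrite /q mulmxDl ipDr mulmx_suml ip_sumr.
    by under eq_bigr do rewrite ip_conj; rewrite addrK.
  have -> : q X x - q Q x = \sum_i q X (B i *m x).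
    rewrite -eqX /q mulmxBl ipDr ipNr opprB addrCA subrr addr0 mulmx_suml ip_sumr.
    by apply: eq_bigr => i _; rewrite ip_conj.
  apply: le_trans (ler_normB _ _) _; apply: lerD; first exact: qV.
  apply: le_trans (ler_norm_sum _ _ _) _; rewrite mulr_sumr.
  by apply: ler_sum => i _.
have w0 : 0 <= w := spnorm_ge0 _.
rewrite -/w; clearbody w; have v0 : 0 <= v.
  have := le_trans (normr_ge0 _) (hv' x1).
  by rewrite pmulr_lge0 // posdef_form.
have kp : 0 < k.
  have := lt_le_trans (posdef_form hX x1_neq0) (XQ x1).
  by move: k0; rewrite le_eqVlt => /orP[/eqP <-|//]; rewrite mul0r ltxx.
have vw : v <= k * z * w.
  (* As [Q >= k^-1 X], the preceding bound has the form [|V| <= w' X], so the least constant [v] is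
     at most [w']. Solving for [v] gives [v <= k z w]. *)
  have : v <= w * z + v * (1 - k^-1).
    apply: vmin => -[x x0] /=; apply: le_trans (step x) _.
    rewrite mulrDl lerD2l -mulrA; apply: ler_wpM2l => //.
    by rewrite mulrBl mul1r lerD2l lerN2 ler_pdivrMl.
  rewrite mulrBr mulr1 addrCA lerDl subr_ge0 ler_pdivrMr // => h.
  by have -> : k * z * w = w * z * k by ring.
apply: spnorm_herm_le; first by rewrite -hermsetE.
  by rewrite !mulr_ge0 ?w0 ?z0 ?k0 ?spnorm_ge0.
move=> x; apply: le_trans (hv' x) _.
apply: (@le_trans _ _ (k * z * w * (spnorm X * l2norm x ^+ 2))).
  by apply: ler_pM; [exact: v0|exact: posdef_form_ge0|exact: vw|exact: Xup].
by rewrite !mulrA (mulrAC _ w).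
Qed.

(** Hermitian matrices form only a real subspace, while the rank argument needs injectivity on all
    complex matrices. If [L V = 0], the Hermitian matrix [V + V^*] is also in the kernel, hence 0;
    then [i V] is Hermitian and in the kernel. *)
Lemma Lop_inj V : Lop B V = 0 -> V = 0.
Proof.
have [K _ hK] := Lop_bounded_below.
have hinj W : hermset W -> Lop B W = 0 -> W = 0.
  move=> hW W0; apply: spnorm_eq0; apply/le_anti; rewrite spnorm_ge0 andbT.
  by have := hK _ hW; rewrite W0 spnorm0 mulr0.
move=> V0.
have /eqP : V + V ^t* = 0.
  apply: hinj; first by rewrite hermsetE linearD /= map_mxD trmxCK addrC.
  by rewrite LopD -Lop_adj V0 linear0 map_mx0 addr0.
rewrite addrC addr_eq0 => /eqP Vadj.
have /eqP : 'i *: V = 0.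
  apply: hinj; last by rewrite LopZ V0 scaler0.
  by rewrite hermsetE linearZ /= map_mxZ Vadj /= conjCi scaleNr scalerN opprK.
by rewrite scaler_eq0 (negPf (neq0Ci _)) => /eqP.
Qed.

Lemma Lop_surj : set_surj hermset hermset (Lop B).
Proof.
move=> W hW; have [V VW] := linear_inj_surj Lop_linear Lop_inj W.
exists V; last exact: VW.
(* The preimage is Hermitian by injectivity: [L] sends [V^* - V] to [W^* - W = 0]. *)
rewrite hermsetE; apply/eqP; rewrite -subr_eq0; apply/eqP.
by apply: Lop_inj; rewrite LopB -Lop_adj VW; move: hW; rewrite hermsetE => ->; rewrite subrr.
Qed.

Lemma LinvK W : hermset W -> Lop B (Linv B W) = W.
Proof. by move=> hW; exact: (@surjpK _ _ (fun=> 0) hermset _ (Lop B) Lop_surj W (mem_set hW)). Qed.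

Lemma Linv_herm W : hermset W -> hermset (Linv B W).
Proof. by move=> hW; apply: (surjpinv_image_sub Lop_surj); exists W. Qed.

Lemma LopK V : hermset V -> Linv B (Lop B V) = V.
Proof.
move=> hV; apply/eqP; rewrite -subr_eq0; apply/eqP; apply: Lop_inj.
by rewrite LopB (LinvK (Lop_herm hV)) subrr.
Qed.

Lemma LinvD V W : hermset V -> hermset W -> Linv B (V + W) = Linv B V + Linv B W.
Proof.
move=> hV hW; rewrite -{1}(LinvK hV) -{1}(LinvK hW) -LopD.
exact: LopK (hermsetD (Linv_herm hV) (Linv_herm hW)).
Qed.

Lemma LinvZ (t : R) V : hermset V -> Linv B (rc t *: V) = rc t *: Linv B V.
Proof.
move=> hV; rewrite -{1}(LinvK hV) -LopZ.
exact: LopK (hermsetZ t (Linv_herm hV)).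
Qed.

Lemma Linv_sum (I : Type) (r : seq I) (F : I -> 'M[C]_n) :
  (forall i, hermset (F i)) ->
  Linv B (\sum_(i <- r) F i) = \sum_(i <- r) Linv B (F i).
Proof.
move=> hF; elim: r => [|i r IH]; last first.
  rewrite !big_cons -IH; apply: LinvD; first exact: hF.
  by apply: hermset_sum => j _; apply: hF.
by rewrite !big_nil -{1}Lop0; apply: LopK; apply: hermset0.
Qed.

End LinearOperator.

Section OperatorNorm.
Variables (R : realType) (n : nat).
Local Notation C := R[i].
Local Notation rc := (real_complex R).
Variables (D : set 'M[C]_n) (F : 'M[C]_n -> 'M[C]_n) (K : R).
Hypothesis DZ : forall t W, D W -> D (rc t *: W).
Hypothesis FZ : forall t W, D W -> F (rc t *: W) = rc t *: F W.
Hypothesis FK : forall W, D W -> spnorm (F W) <= K * spnorm W.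

(** The a priori constant [K] does not enter the conclusion: it makes the [sup] finite and settles
    the arguments of norm 0. *)
Lemma opnorm_ub W : D W -> spnorm (F W) <= opnorm D F * spnorm W.
Proof.
move=> DW; have [W0|W0] := eqVneq (spnorm W) 0.
  by have := FK DW; rewrite W0 !mulr0.
have Wp : 0 < spnorm W by rewrite lt_neqAle eq_sym W0 spnorm_ge0.
have : spnorm (F (rc (spnorm W)^-1 *: W)) <= opnorm D F.
  apply: ub_le_sup.
    by exists K => _ [V /= [DV V1] <-]; have := FK DV; rewrite V1 mulr1.
  exists (rc (spnorm W)^-1 *: W) => //=; split; first exact: DZ.
  by rewrite spnormZ ger0_norm ?invr_ge0 ?spnorm_ge0 // mulVf.
rewrite FZ // spnormZ ger0_norm ?invr_ge0 ?spnorm_ge0 //.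
by rewrite ler_pdivrMl // mulrC.
Qed.

End OperatorNorm.

(** * Quantitative uniqueness of the positive definite solution *)

Section Stability.
Variables (R : realType) (m n : nat) (hn : (0 < n)%N).
Local Notation C := R[i].
Variables (A : 'I_m -> 'M[C]_n) (Q T Y E : 'M[C]_n) (c d g e : R).
Hypotheses (hT : posdef T) (hY : posdef Y).
Hypothesis eqT : T - \sum_i (A i) ^t* *m invmx T *m A i = Q.
Hypothesis eqY : Y - \sum_i (A i) ^t* *m invmx Y *m A i = Q + E.
Hypotheses (c0 : 0 < c) (d0 : 0 < d) (g0 : 0 < g).
Hypothesis Qc : forall x, c * l2norm x ^+ 2 <= ip x (Q *m x).
Hypothesis Td : forall x, ip x (T *m x) <= d * l2norm x ^+ 2.
Hypothesis Yd : forall x, ip x (Y *m x) <= d * l2norm x ^+ 2.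
Hypothesis Tg : forall x, g * l2norm x ^+ 2 <= ip x (T *m x).
Hypothesis Yg : forall x, g * l2norm x ^+ 2 <= ip x (Y *m x).
Hypothesis Ee : spnorm E <= e.

Lemma form_fixed_eq Z W x : Z - \sum_i (A i) ^t* *m invmx Z *m A i = W ->
  ip x (Z *m x) - ip x (W *m x) = \sum_i ip (A i *m x) (invmx Z *m (A i *m x)).
Proof.
move=> <-; rewrite mulmxBl ipDr ipNr mulmx_suml ip_sumr.
by under eq_bigr do rewrite ip_conj; rewrite opprB addrC subrK.
Qed.

(* Comparison in the Thompson metric: [V |-> sum_i A_i^* V^-1 A_i] reverses the
   order, and adding [Q] makes it a strict contraction. *)
Lemma solution_stability : 2 * d * e <= c * g ->
  spnorm (Y - T) <= 2 * d ^+ 2 * e / (c * g).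
Proof.
move=> he; have e0 : 0 <= e := le_trans (spnorm_ge0 _) Ee.
pose q (W : 'M[C]_n) x := ip x (W *m x).
have Ex x : `|q E x| <= e * l2norm x ^+ 2.
  apply: le_trans (ip_le_spnorm E x) _.
  by apply: ler_wpM2r; [exact: sqr_ge0|exact: Ee].
have [x1 x1_neq0] := exists_neq0 R hn.
(* The boolean index puts [Y <= t T] and [T <= t Y] into one family of ratios; its least bound [t]
   is the exponential of the Thompson distance. The crude bound [d / g] makes it finite. *)
pose f (p : {x : 'cV[C]_n | x != 0} * bool) := q (if p.2 then Y else T) (sval p.1).
pose h (p : {x : 'cV[C]_n | x != 0} * bool) := q (if p.2 then T else Y) (sval p.1).
have bound : forall p, f p <= (d / g) * h p.
  have aux u v w : u <= d * w -> g * w <= v -> u <= d / g * v.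
    move=> u1 v1; apply: le_trans u1 _; rewrite -mulrA; apply: ler_wpM2l.
      exact: ltW.
    by rewrite ler_pdivlMl.
  move=> [[x x0] []]; first exact: aux (Yd x) (Tg x).
  exact: aux (Td x) (Yg x).
have hd p : h p <= d * l2norm (sval p.1) ^+ 2.
  by case: p => [[x x0] []]; [exact: Td|exact: Yd].
have hg p : g * l2norm (sval p.1) ^+ 2 <= h p.
  by case: p => [[x x0] []]; [exact: Tg|exact: Yg].
have hpos p : 0 < h p.
  by case: p => [[x x0] []]; rewrite /h /=; apply: posdef_form.
have [t ht tmin] := @least_ratio R _ f h (d / g) (exist _ x1 x1_neq0, true) hpos bound.
have YT x : q Y x <= t * q T x.
  have [->|x0] := eqVneq x 0; first by rewrite /q !mulmx0 !ip0r mulr0.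
  exact: ht (exist _ x x0, true).
have TY x : q T x <= t * q Y x.
  have [->|x0] := eqVneq x 0; first by rewrite /q !mulmx0 !ip0r mulr0.
  exact: ht (exist _ x x0, false).
have [t1 tp] : 1 <= t /\ 0 < t.
  have := YT x1; have := TY x1.
  have := posdef_form hT x1_neq0; have := posdef_form hY x1_neq0.
  rewrite -/(q Y x1) -/(q T x1); move: (q Y x1) (q T x1) => a b a0 b0 ab ba.
  have tp : 0 < t by have := lt_le_trans a0 ba; rewrite pmulr_lgt0.
  split=> //; rewrite leNgt; apply/negP => tl.
  have : t * a < 1 * a by rewrite ltr_pM2r.
  have : t * b < 1 * b by rewrite ltr_pM2r.
  by lra.
(* If [Z <= t W] then [W^-1 <= t Z^-1]; conjugating by each [A i] and summing, the equations turn
   the two sides into [W - S] and [t (Z - P)]. *)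
have inv_le Z W P S (hZ : posdef Z) (hW : posdef W) x :
    Z - \sum_i (A i) ^t* *m invmx Z *m A i = P ->
    W - \sum_i (A i) ^t* *m invmx W *m A i = S ->
    (forall x, q Z x <= t * q W x) ->
    q W x - q S x <= t * (q Z x - q P x).
  move=> eZ eW ZW; rewrite (form_fixed_eq x eZ) (form_fixed_eq x eW) mulr_sumr.
  by apply: ler_sum => i _; exact: posdef_inv_antitone hZ hW ZW.
have qQE x : q (Q + E) x = q Q x + q E x by rewrite /q mulmxDl ipDr.
have upper (V H r S k l : R) : V <= t * H - (t - 1) * r + S ->
    (t - 1) * (k * H) <= (t - 1) * r -> S <= t * (l * H) ->
    V <= (t - (t - 1) * k + t * l) * H.
  by move=> h1 h2 h3; lra.
have shiftl (a b r s : R) : a - (r + s) <= t * (b - r) -> a <= t * b - (t - 1) * r + s.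
  by move=> h1; lra.
have shiftr (a b r s : R) : b - r <= t * (a - (r + s)) ->
    b <= t * a - (t - 1) * r + t * - s.
  by move=> h1; lra.
(* The inequality is proved with a new constant on the right, and minimality of [t] applies. The
   gain [(t - 1) (c / d)] comes from [Q], which is not multiplied by [t]; the loss [t (e / g)] comes
   from the residual [E]. *)
have main : t <= t - (t - 1) * (c / d) + t * (e / g).
  apply: tmin => -[[x x0] b].
  have k1 : c / d * h ((exist _ x x0), b) <= q Q x.
    apply: le_trans (Qc x); rewrite -mulrA; apply: ler_wpM2l; first exact: ltW.
    by rewrite (ler_pdivrMl _ _ d0); exact: hd (exist _ x x0, b).
  have k2 : e * l2norm x ^+ 2 <= e / g * h ((exist _ x x0), b).
    rewrite -mulrA; apply: ler_wpM2l; first exact: e0.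
    by rewrite (ler_pdivlMl _ _ g0); exact: hg (exist _ x x0, b).
  have k3 : (t - 1) * (c / d * h ((exist _ x x0), b)) <= (t - 1) * q Q x.
    by apply: ler_wpM2l; [rewrite subr_ge0|exact: k1].
  have k4 : t * (e * l2norm x ^+ 2) <= t * (e / g * h ((exist _ x x0), b)).
    by apply: ler_wpM2l; [exact: ltW|exact: k2].
  have /ler_normlP[k5 k6] := Ex x.
  have n0 : 0 <= e * l2norm x ^+ 2 by rewrite mulr_ge0 ?sqr_ge0.
  have k7 : e * l2norm x ^+ 2 <= t * (e * l2norm x ^+ 2) by rewrite ler_peMl.
  have k8 : t * - q E x <= t * (e * l2norm x ^+ 2).
    by apply: ler_wpM2l; [exact: ltW|exact: k5].
  have sT := inv_le _ _ _ _ hT hY x eqT eqY TY; have sY := inv_le _ _ _ _ hY hT x eqY eqT YT.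
  rewrite qQE in sT sY.
  case: b k3 k4 {k1 k2} => k3 k4; rewrite /f /h /= in k3 k4 *.
    apply: (upper _ _ _ (q E x) _ _ _ k3 (le_trans (le_trans k6 k7) k4)).
    exact: shiftl sT.
  apply: (upper _ _ _ (t * - q E x) _ _ _ k3 (le_trans k8 k4)).
  exact: shiftr sY.
have cg := mulr_gt0 c0 g0.
(* The gain and loss give [(t - 1) c g <= (t - 1) d e + d e]; by [he] the first term on the right is
   at most half of the left side, whence the factor 2. *)
have t2 : t - 1 <= 2 * d * e / (c * g).
  have : (t - 1) * (c / d) <= t * (e / g) by move: main; move: (_ * _) (_ * _) => y1 y2; lra.
  rewrite !mulrA ler_pdivrMr // mulrAC ler_pdivlMr // ler_pdivlMr // => h1.
  have : 0 <= t - 1 by rewrite subr_ge0.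
  by move=> t0; have := ler_wpM2l t0 he; lra.
have t0 : 0 <= t - 1 by rewrite subr_ge0.
apply: (@le_trans _ _ ((t - 1) * d)); last first.
  have -> : 2 * d ^+ 2 * e / (c * g) = 2 * d * e / (c * g) * d by field; rewrite !gt_eqF.
  by apply: ler_wpM2r; [exact: ltW|exact: t2].
apply: spnorm_herm_le.
- by have := hermsetB (proj1 hY) (proj1 hT); rewrite hermsetE.
- by rewrite mulr_ge0 // ltW.
move=> x; rewrite mulmxBl ipDr ipNr -mulrA ler_norml.
have k1 := ler_wpM2l t0 (Td x); have k2 := ler_wpM2l t0 (Yd x).
have := YT x; have := TY x; rewrite /q; move: k1 k2.
move: (ip x (Y *m x)) (ip x (T *m x)) (d * _) => a b w k1 k2 k3 k4.
by apply/andP; split; lra.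
Qed.

End Stability.

(* In terms of [v = zeta * s] the fixed-point equation of the majorant reads
   [(l + theta) v^2 - l (1 + w - sigma) v + l w = 0] with [w = zeta * eps], and
   the hypothesis on [w] says that its discriminant is positive. *)
Lemma majorant_root_scaled (R : rcfType) (l th si w : R) :
  0 < l -> 0 <= th -> 0 <= si < 1 -> 0 <= w ->
  w * (l + l * si + 2 * th + 2 * Num.sqrt ((l * si + th) * (th + l)))
    < l * (1 - si) ^+ 2 ->
  let b := l * (1 + w - si) in
  let v := 2 * l * w / (b + Num.sqrt (b ^+ 2 - 4 * l * w * (l + th))) in
  [/\ 0 < b, 0 <= v < 1, l * w * (1 - v) + l * si * v + th * v ^+ 2 = l * v * (1 - v)
    & l * si + th < (l + th) * (1 - v) ^+ 2].
Proof.
move=> l0 th0 /andP[si0 si1] w0 hw b; set D := b ^+ 2 - _; set d := Num.sqrt D => v.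
set p := l + l * si + 2 * th in hw; set r0 := Num.sqrt _ in hw.
have r00 : 0 <= r0 by apply: sqrtr_ge0.
have lsi : 0 <= l * si by rewrite mulr_ge0 // ltW.
have r0E : r0 ^+ 2 = (l * si + th) * (th + l).
  by rewrite sqr_sqrtr // mulr_ge0 // addr_ge0 // ltW.
have p0 : 0 < p by rewrite /p; lra.
have b0 : 0 < b by rewrite mulr_gt0 //; lra.
(* Since [(p - 2 r0) (p + 2 r0) = l^2 (1 - si)^2], the hypothesis says that [l w] lies below the
   smaller root of the discriminant [D = (p - l w)^2 - 4 r0^2], seen as a polynomial in [l w]. *)
have lw : l * w < p - 2 * r0.
  have pr : 0 < p + 2 * r0 by lra.
  rewrite -(ltr_pM2r pr).
  have -> : (p - 2 * r0) * (p + 2 * r0) = l * (l * (1 - si) ^+ 2).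
    have -> : (p - 2 * r0) * (p + 2 * r0) = p ^+ 2 - 4 * r0 ^+ 2 by ring.
    by rewrite r0E /p; ring.
  by rewrite -mulrA ltr_pM2l.
have D0 : 0 < D.
  have -> : D = (p - l * w - 2 * r0) * (p - l * w + 2 * r0).
    have -> : (p - l * w - 2 * r0) * (p - l * w + 2 * r0) = (p - l * w) ^+ 2 - 4 * r0 ^+ 2.
      by ring.
    by rewrite r0E /D /b /p; ring.
  by rewrite mulr_gt0 //; lra.
have d0 : 0 < d by rewrite sqrtr_gt0.
have dE : d ^+ 2 = D by rewrite sqr_sqrtr // ltW.
have t0 : 0 < l + th by lra.
(* Rationalizing shows that [v] is the smaller root of the quadratic. *)
have vE : v = (b - d) / (2 * (l + th)).
  have h : (b - d) * (b + d) = 4 * l * w * (l + th).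
    have -> : (b - d) * (b + d) = b ^+ 2 - d ^+ 2 by ring.
    by rewrite dE /D; ring.
  have bd : b + d != 0 by rewrite gt_eqF // addr_gt0.
  have -> : b - d = 4 * l * w * (l + th) / (b + d) by rewrite -h mulfK.
  by rewrite /v; field; rewrite gt_eqF ?bd.
have vb : 2 * (l + th) * v = b - d by rewrite vE mulrC divfK // mulf_neq0 ?gt_eqF.
have v0 : 0 <= v by rewrite /v divr_ge0 ?mulr_ge0 ?addr_ge0 // ltW.
have v1 : v < 1.
  have b2 : b < 2 * (l + th) by rewrite /b; move: lw; rewrite /p; lra.
  have : 2 * (l + th) * v < 2 * (l + th) * 1 by lra.
  by rewrite ltr_pM2l //; lra.
have root : (l + th) * v ^+ 2 - b * v + l * w = 0.
  have : (2 * (l + th) * v - b) ^+ 2 = D by rewrite vb -dE; ring.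
  rewrite /D => h.
  have : 4 * (l + th) * ((l + th) * v ^+ 2 - b * v + l * w) = 0 by lra.
  by move/eqP; rewrite !mulf_eq0 (gt_eqF t0) pnatr_eq0 /= => /eqP.
clearbody v d D r0; split => //; first by rewrite v0.
  by move: root; rewrite /b; lra.
have u0 : 0 < 1 - v by lra.
(* In [u = 1 - v] the quadratic is [(l + th) u^2 - (2 (l + th) - b) u + (l si + th) = 0]. As
   [d > 0], [u] is strictly its larger root, so [u^2] exceeds the product of the roots. *)
have : (1 - v) * (2 * (l + th) - b) < (1 - v) * (2 * (l + th) * (1 - v)).
  by rewrite ltr_pM2l //; lra.
by move: root; rewrite /b; lra.
Qed.

Lemma majorant_root (R : rcfType) (l z th si e : R) :
  0 < l -> 0 < z -> 0 <= th -> 0 <= si < 1 -> 0 <= e ->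
  e < l * (1 - si) ^+ 2 /
      (z * (l + l * si + 2 * th + 2 * Num.sqrt ((l * si + th) * (th + l)))) ->
  let s := 2 * l * e / (l * (1 + z * e - si)
     + Num.sqrt (l ^+ 2 * (1 + z * e - si) ^+ 2 - 4 * l * z * e * (l + th))) in
  [/\ 0 <= s, z * s < 1,
      e + si * s / (1 - z * s) + th * z * s ^+ 2 / (l * (1 - z * s)) = s
    & si / (1 - z * s) ^+ 2 + th / l * ((1 - z * s)^-1 ^+ 2 - 1) < 1].
Proof.
move=> l0 z0 th0 si01 e0 he.
have /andP[si0 si1] := si01.
have lsi : 0 <= l * si by rewrite mulr_ge0 // ltW.
have hw : z * e * (l + l * si + 2 * th + 2 * Num.sqrt ((l * si + th) * (th + l)))
    < l * (1 - si) ^+ 2.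
  rewrite mulrAC -ltr_pdivlMl; last first.
    by rewrite mulr_gt0 // ltr_pwDl ?mulr_ge0 ?sqrtr_ge0 //; lra.
  by rewrite mulrC.
have w0 : 0 <= z * e by rewrite mulr_ge0 // ltW.
have := majorant_root_scaled l0 th0 si01 w0 hw; cbv zeta.
set b := l * (1 + z * e - si); set D := b ^+ 2 - 4 * l * (z * e) * (l + th).
set v := 2 * l * (z * e) / _ => -[] b0 /andP[v0 v1] vE vlt.
have -> : l ^+ 2 * (1 + z * e - si) ^+ 2 - 4 * l * z * e * (l + th) = D.
  by rewrite /D /b; ring.
have zs : v = z * (2 * l * e / (b + Num.sqrt D)).
  by rewrite /v; move: (b + _)^-1 => k; ring.
set s := 2 * l * e / (b + Num.sqrt D) in zs *; rewrite -zs.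
clearbody v s; have u0 : 0 < 1 - v by lra.
have sE : s = v / z by rewrite zs mulrAC divff ?mul1r // gt_eqF.
have u_neq0 : 1 - v != 0 by rewrite gt_eqF.
have l_neq0 : l != 0 by rewrite gt_eqF.
have z_neq0 : z != 0 by rewrite gt_eqF.
split => //; first by rewrite sE divr_ge0 // ltW.
  have -> : e + si * s / (1 - v) + th * z * s ^+ 2 / (l * (1 - v)) =
    (l * (z * e) * (1 - v) + l * si * v + th * v ^+ 2) / (l * z * (1 - v)).
    by rewrite sE; field; rewrite u_neq0 l_neq0 z_neq0.
  by rewrite vE sE; field; rewrite u_neq0 l_neq0 z_neq0.
rewrite -subr_gt0.
have -> : 1 - (si / (1 - v) ^+ 2 + th / l * ((1 - v)^-1 ^+ 2 - 1)) =
   ((l + th) * (1 - v) ^+ 2 - (l * si + th)) / (l * (1 - v) ^+ 2).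
  by field; rewrite u_neq0 l_neq0.
by rewrite divr_gt0 ?subr_gt0 // mulr_gt0 // exprn_gt0.
Qed.

(** With [y = z / (1 - z s)], [k = l^-1] and [sigma = z l^-1 S], the norm bound for [step] on the
    ball becomes the right side of the majorant equation. *)
Lemma majorant_valueE (F : fieldType) (l z th S e s : F) : 1 - z * s != 0 -> l != 0 ->
  e + l^-1 * (th * (s * (z / (1 - z * s)) * s) + S * (s * (z / (1 - z * s)))) =
  e + z * l^-1 * S * s / (1 - z * s) + th * z * s ^+ 2 / (l * (1 - z * s)).
Proof. by move=> u0 l0; field; rewrite u0 l0. Qed.

(** Here [1 + s y = (1 - z s)^-1], so the Lipschitz constant of [step] is the derivative of the
    majorant in [s]. *)
Lemma majorant_slopeE (F : fieldType) (l z th S s : F) : 1 - z * s != 0 -> l != 0 ->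
  l^-1 * (th * ((1 + s * (z / (1 - z * s))) ^+ 2 - 1)
          + S * ((1 + s * (z / (1 - z * s))) * (z / (1 - z * s)))) =
  z * l^-1 * S / (1 - z * s) ^+ 2 + th / l * ((1 - z * s)^-1 ^+ 2 - 1).
Proof. by move=> u0 l0; field; rewrite u0 l0. Qed.

(** Bernoulli's inequality for [q^-1 = 1 + h] together with the archimedean property. *)
Lemma geometric_small (R : realType) (q K e : R) :
  0 <= q < 1 -> 0 <= K -> 0 < e -> exists k, K * q ^+ k < e.
Proof.
move=> /andP[q0 q1] K0 e0.
have [->|q_neq0] := eqVneq q 0; first by exists 1%N; rewrite expr1 mulr0.
have qp : 0 < q by rewrite lt_neqAle eq_sym q_neq0.
pose h := q^-1 - 1.
have h0 : 0 < h by rewrite subr_gt0 invf_gt1.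
have hE : q^-1 = 1 + h by rewrite addrC subrK.
clearbody h.
have bern k : 1 + k%:R * h <= (q^-1) ^+ k.
  rewrite hE; elim: k => [|k IH]; first by rewrite mul0r addr0 expr0.
  have : (1 + h) * (1 + k%:R * h) <= (1 + h) * (1 + h) ^+ k by rewrite ler_pM2l // addr_gt0.
  have : 0 <= k%:R * h ^+ 2 by rewrite mulr_ge0 ?sqr_ge0.
  by rewrite (exprS _ k) -natr1; move: (k%:R) ((1 + h) ^+ k) => x y; lra.
have [k hk] : exists k, K / (e * h) < k%:R.
  exists (Num.bound (K / (e * h))); apply: archi_boundP.
  by rewrite divr_ge0 // mulr_ge0 // ltW.
exists k; rewrite -ltr_pdivlMr ?exprn_gt0 // -exprVn.
rewrite ltr_pdivrMr ?mulr_gt0 // in hk.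
have := bern k; move: (q^-1 ^+ k) => x hx.
have : e * (1 + k%:R * h) <= e * x by rewrite ler_pM2l.
by lra.
Qed.

(** * The nonlinear remainder: size and Lipschitz constant *)

Section NonlinearPart.
Variables (R : realType) (n : nat).
Local Notation C := R[i].
Variables (A D B V : 'M[C]_n).
Implicit Types (H Y : 'M[C]_n).

(* [V] and [Y] stand for [X^-1] and [(X + H)^-1]. *)
Definition nonlin H Y : 'M[C]_n :=
  B ^t* *m (H *m Y *m H) *m B - B ^t* *m (H *m Y) *m D
  - D ^t* *m (V *m (H *m Y)) *m (A + D).

(** The first-order change of [A^* Y A] is [- A^* V H V A = - B^* H B], which cancels the term of
    [L]. Besides terms in the data alone there remains [nonlin], every summand of which contains
    [H]. Expanding [A^* Y A] to second order uses the resolvent identity on both sides. *)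
Lemma nonlinE H Y : V ^t* = V -> B = V *m A ->
  Y = V - V *m H *m Y -> Y = V - Y *m H *m V ->
  B ^t* *m H *m B + (A + D) ^t* *m Y *m (A + D) - A ^t* *m V *m A =
  (B ^t* *m D + D ^t* *m B) + D ^t* *m V *m D + nonlin H Y.
Proof.
move=> Vh BE Y1 Y2; have BaE : B ^t* = A ^t* *m V by rewrite BE trmxCM Vh.
have adjD : (A + D) ^t* = A ^t* + D ^t* by rewrite linearD /= map_mxD.
have hL (P S : 'M_n) : P *m Y *m S = P *m V *m S - P *m (V *m (H *m Y)) *m S.
  by rewrite {1}Y1 mulmxBr mulmxBl (mulmxA V).
have hR (P S : 'M_n) : P *m (H *m Y) *m S = P *m H *m (V *m S) - P *m (H *m Y *m H) *m (V *m S).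
  by rewrite {1}Y2 mulmxBr mulmxBr mulmxBl !mulmxA.
have h1 : D ^t* *m Y *m (A + D) =
  D ^t* *m B + D ^t* *m V *m D - D ^t* *m (V *m (H *m Y)) *m (A + D).
  by rewrite hL mulmxDr -(mulmxA _ V A) -BE.
have h2 : A ^t* *m Y *m D = B ^t* *m D - B ^t* *m (H *m Y) *m D.
  by rewrite hL (mulmxA (A ^t*) V (H *m Y)) -BaE.
have h3 : A ^t* *m Y *m A = A ^t* *m V *m A - (B ^t* *m H *m B - B ^t* *m (H *m Y *m H) *m B).
  by rewrite (hL (A ^t*) A) (mulmxA (A ^t*) V (H *m Y)) -BaE hR -BE.
have -> : (A + D) ^t* *m Y *m (A + D) =
   A ^t* *m Y *m A + A ^t* *m Y *m D + D ^t* *m Y *m (A + D).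
  by rewrite adjD !mulmxDl mulmxDr.
have group (a1 a2 a3 a4 a5 a6 a7 a8 : 'M[C]_n) :
  a1 + (a2 - (a1 - a3) + (a4 - a5) + (a6 + a7 - a8)) - a2 =
  a4 + a6 + a7 + (a3 - a5 - a8).
  by apply/matrixP => i j; rewrite !mxE; ring.
by rewrite h1 h2 h3 group.
Qed.

Variables (s y : R).
Hypotheses (s0 : 0 <= s) (y0 : 0 <= y).

Lemma spnormM_le F G (f g : R) : spnorm F <= f -> spnorm G <= g ->
  spnorm (F *m G : 'M[C]_n) <= f * g.
Proof.
move=> hf hg; apply: le_trans (spnormM _ _) _.
exact: ler_pM (spnorm_ge0 F) (spnorm_ge0 G) hf hg.
Qed.

Lemma spnormD_le F G (f g : R) : spnorm F <= f -> spnorm G <= g ->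
  spnorm (F + G : 'M[C]_n) <= f + g.
Proof. by move=> hf hg; exact: le_trans (spnormD F G) (lerD hf hg). Qed.

Lemma spnormB_le F G (f g : R) : spnorm F <= f -> spnorm G <= g ->
  spnorm (F - G : 'M[C]_n) <= f + g.
Proof. by move=> hf hg; apply: (spnormD_le hf); rewrite spnormN; exact: hg. Qed.

(** The remainder is linear in the pair [(H Y H, H Y)], so one estimate serves both its values and
    its differences; the coefficient of [g] is the summand of [sigma]. *)
Lemma nonlin_shape_bound F G (f g : R) : spnorm F <= f -> spnorm G <= g ->
  spnorm (B ^t* *m F *m B - B ^t* *m G *m D - D ^t* *m (V *m G) *m (A + D)) <=
  spnorm B ^+ 2 * f
  + ((spnorm A + spnorm D) * spnorm V + spnorm B) * spnorm D * g.
Proof.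
move=> hf hg.
have adj_le (M : 'M[C]_n) : spnorm (M ^t*) <= spnorm M by rewrite spnorm_adj.
have hB := adj_le B; have hD := adj_le D.
have h1 : spnorm (B ^t* *m F *m B) <= spnorm B * f * spnorm B.
  exact: spnormM_le (spnormM_le hB hf) (lexx _).
have h2 : spnorm (B ^t* *m G *m D) <= spnorm B * g * spnorm D.
  exact: spnormM_le (spnormM_le hB hg) (lexx _).
have h3 : spnorm (D ^t* *m (V *m G) *m (A + D)) <=
    spnorm D * (spnorm V * g) * (spnorm A + spnorm D).
  exact: spnormM_le (spnormM_le hD (spnormM_le (lexx _) hg)) (spnormD _ _).
apply: le_trans (spnormB_le (spnormB_le h1 h2) h3) _.
have norm_eq (a b d v f' g' : R) : b * f' * b + b * g' * d + d * (v * g') * (a + d) =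
  b ^+ 2 * f' + ((a + d) * v + b) * d * g' by ring.
by rewrite norm_eq.
Qed.

Lemma nonlin_bound H Y : spnorm H <= s -> spnorm Y <= y ->
  spnorm (nonlin H Y) <= spnorm B ^+ 2 * (s * y * s)
  + ((spnorm A + spnorm D) * spnorm V + spnorm B) * spnorm D * (s * y).
Proof.
move=> hH hY; have hHY := spnormM_le hH hY.
exact: nonlin_shape_bound (spnormM_le hHY hH) hHY.
Qed.

Lemma nonlin_lipschitz H Y H' Y' : spnorm H <= s -> spnorm Y <= y ->
  spnorm H' <= s -> spnorm Y' <= y -> Y' - Y = Y' *m (H - H') *m Y ->
  spnorm (nonlin H Y - nonlin H' Y') <=
  (spnorm B ^+ 2 * ((1 + s * y) ^+ 2 - 1)
  + ((spnorm A + spnorm D) * spnorm V + spnorm B) * spnorm D * ((1 + s * y) * y))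
  * spnorm (H - H').
Proof.
move=> hH hY hH' hY'.
have [d dE] : exists d, d = H - H' by exists (H - H').
rewrite -dE => YE.
(* The resolvent identity writes the difference with a single factor [d] in each term, so that with
   [r = s y] the norm estimates sum to [1 + r] here and to [2 r + r^2 = (1 + r)^2 - 1] for
   [H Y H]. *)
have pE : H *m Y - H' *m Y' = d *m Y - H' *m Y' *m d *m Y.
  have -> : H' *m Y' *m d *m Y = H' *m Y' - H' *m Y.
    by rewrite -!mulmxA (mulmxA Y') -YE mulmxBr.
  by rewrite dE mulmxBl opprB addrA subrK.
have FE : H *m Y *m H - H' *m Y' *m H' =
   H' *m Y' *m d + d *m (Y *m H) - H' *m Y' *m d *m (Y *m H).
  rewrite -addrA; have -> : d *m (Y *m H) - H' *m Y' *m d *m (Y *m H) =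
    (H *m Y - H' *m Y') *m H by rewrite pE mulmxBl !mulmxA.
  by rewrite mulmxBl dE mulmxBr [RHS]addrC addrA subrK.
have hd := lexx (spnorm d).
have hp : spnorm (H' *m Y') <= s * y := spnormM_le hH' hY'.
have hp' : spnorm (Y *m H) <= s * y by rewrite mulrC; exact: spnormM_le hY hH.
have hF : spnorm (H *m Y *m H - H' *m Y' *m H') <= ((1 + s * y) ^+ 2 - 1) * spnorm d.
  rewrite FE; have hpd := spnormM_le hp hd.
  apply: le_trans (spnormB_le (spnormD_le hpd (spnormM_le hd hp')) (spnormM_le hpd hp')) _.
  have expand (e r : R) : r * e + e * r + r * e * r = ((1 + r) ^+ 2 - 1) * e by ring.
  by rewrite expand.
have hG : spnorm (H *m Y - H' *m Y') <= (1 + s * y) * y * spnorm d.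
  rewrite pE; apply: le_trans (spnormB_le (spnormM_le hd hY) (spnormM_le (spnormM_le hp hd) hY)) _.
  have expand (e r w : R) : e * w + r * e * w = (1 + r) * w * e by ring.
  by rewrite expand.
have -> : nonlin H Y - nonlin H' Y' =
   B ^t* *m (H *m Y *m H - H' *m Y' *m H') *m B - B ^t* *m (H *m Y - H' *m Y') *m D
   - D ^t* *m (V *m (H *m Y - H' *m Y')) *m (A + D).
  have distr (P M M' S : 'M[C]_n) : P *m (M - M') *m S = P *m M *m S - P *m M' *m S.
    by rewrite mulmxBr mulmxBl.
  have group (a1 a2 a3 b1 b2 b3 : 'M[C]_n) :
    a1 - a2 - a3 - (b1 - b2 - b3) = a1 - b1 - (a2 - b2) - (a3 - b3).
    by apply/matrixP => i j; rewrite !mxE; ring.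
  by rewrite (mulmxBr V) !distr; exact: group.
apply: le_trans (nonlin_shape_bound hF hG) _.
have factor (b x c w e : R) : b * (x * e) + c * (w * e) = (b * x + c * w) * e by ring.
by rewrite factor.
Qed.

End NonlinearPart.

(** * The fixed-point map on the ball and its iterates *)

Section Perturbation.
Variables (R : realType) (m n : nat) (hn : (0 < n)%N).
Local Notation C := R[i].
Local Notation rc := (real_complex R).
Variables (A D : 'I_m -> 'M[C]_n) (X Q tQ : 'M[C]_n).
Hypotheses (hQ : posdef Q) (htQ : posdef tQ) (hX : posdef X).
Hypothesis eqX : X - \sum_i (A i) ^t* *m invmx X *m A i = Q.
Implicit Types (H W : 'M[C]_n).

Local Notation V := (invmx X).
Local Notation B := (fun i => invmx X *m A i).
Local Notation k := (opnorm hermset (Linv B)).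
Local Notation z := (spnorm (invmx X)).

Let Vh : V ^t* = V.
Proof. by have := hermset_inv (proj1 hX); rewrite hermsetE. Qed.

(** Since [A_i^* X^-1 A_i = B_i^* X B_i], the equation takes the form required by the lemmas on
    [L]. *)
Let eqB : X - \sum_i (B i) ^t* *m X *m B i = Q.
Proof.
rewrite -eqX; congr (_ - _); apply: eq_bigr => i _.
by rewrite trmxCM Vh -!mulmxA (mulKVmx (posdef_unitmx hX)).
Qed.

Lemma spnorm_Linv_bounded :
  exists K, forall W, hermset W -> spnorm (Linv B W) <= K * spnorm W.
Proof.
have [K _ hK] := Lop_bounded_below hn hX hQ eqB; exists K => W hW.
have := hK _ (Linv_herm hn hX hQ eqB hW).
by rewrite (LinvK hn hX hQ eqB hW).
Qed.

Lemma spnorm_Linv W : hermset W -> spnorm (Linv B W) <= k * spnorm W.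
Proof.
have [K hK] := spnorm_Linv_bounded.
apply: (opnorm_ub (K := K)) => [t {}W|t {}W|//].
  exact: hermsetZ.
exact: (LinvZ hn hX hQ eqB).
Qed.

Lemma opnorm_Linv_gt0 : 0 < k.
Proof.
have h1 : hermset (1%:M : 'M[C]_n) by rewrite hermsetE trmxC1.
have : 0 < k * spnorm (1%:M : 'M[C]_n).
  apply: lt_le_trans (spnorm_Linv h1).
  rewrite lt_neqAle spnorm_ge0 andbT eq_sym; apply/eqP => /spnorm_eq0 h.
  have := LinvK hn hX hQ eqB h1; rewrite h Lop0 => /matrixP/(_ (Ordinal hn) (Ordinal hn)).
  by rewrite !mxE eqxx => /eqP; rewrite eq_sym oner_eq0.
by rewrite pmulr_lgt0 ?spnorm1_gt0.
Qed.

Lemma spnorm_Pop i W : spnorm (Pop B i W) <= opnorm setT (Pop B i) * spnorm W.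
Proof.
apply: (opnorm_ub (K := k * (spnorm (B i) + spnorm (B i)))) => // [t {}W _|{}W _].
  rewrite /Pop trmxCZ -scalemxAr -scalemxAl -scalerDr.
  exact: (LinvZ hn hX hQ eqB) (hermset_symM _ _).
apply: le_trans (spnorm_Linv (hermset_symM _ _)) _; rewrite -mulrA.
apply: ler_wpM2l; first exact/ltW/opnorm_Linv_gt0.
rewrite mulrDl; apply: le_trans (spnormD _ _) _; apply: lerD.
  by apply: le_trans (spnormM _ _) _; rewrite spnorm_adj.
by rewrite mulrC; apply: le_trans (spnormM _ _) _; rewrite spnorm_adj.
Qed.

Definition rhs H : 'M[C]_n := tQ - Q +
  \sum_i ((B i) ^t* *m H *m B i + (A i + D i) ^t* *m invmx (X + H) *m (A i + D i)
          - (A i) ^t* *m V *m A i).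

(** [L H - rhs H] is the residual of [X + H] in the perturbed equation; the [B_i^* H B_i] added on
    both sides cancels. *)
Lemma Lop_sub_rhs H : Lop B H - rhs H =
  X + H - \sum_i (A i + D i) ^t* *m invmx (X + H) *m (A i + D i) - tQ.
Proof.
rewrite /rhs /Lop sumrB big_split /=.
have group (a b c d e f : 'M[C]_n) : a + b - (c - (d - e) + (b + f - e)) = d + a - f - c.
  by apply/matrixP => i j; rewrite !mxE; ring.
by rewrite -eqX group.
Qed.

Variable s : R.
Hypotheses (s0 : 0 <= s) (zs : z * s < 1).

Let y := z / (1 - z * s).

Definition in_ball H := hermset H /\ spnorm H <= s.

Lemma ball_posdef H : in_ball H -> posdef (X + H).
Proof.
move=> [hH Hs]; apply: posdef_add hX hH _; apply: le_lt_trans zs.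
by apply: ler_wpM2l; [exact: spnorm_ge0|exact: Hs].
Qed.

Lemma ball_spnorm_inv H : in_ball H -> spnorm (invmx (X + H)) <= y.
Proof. by move=> [hH Hs]; exact: spnorm_invD hX hH Hs zs. Qed.

Lemma ball_invl H : in_ball H -> invmx (X + H) = V - V *m H *m invmx (X + H).
Proof. by move=> bH; exact: invmxD (posdef_unitmx hX) (posdef_unitmx (ball_posdef bH)). Qed.

Lemma ball_invr H : in_ball H -> invmx (X + H) = V - invmx (X + H) *m H *m V.
Proof.
move=> bH; have Yh := posdef_adj (posdef_inv (ball_posdef bH)).
have hH : H ^t* = H by rewrite -hermsetE; case: bH.
by rewrite -{1}Yh {1}(ball_invl bH) linearB /= map_mxB !trmxCM Vh hH Yh mulmxA.
Qed.

Lemma ball_inv_sub H H' : in_ball H -> in_ball H' ->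
  invmx (X + H') - invmx (X + H) = invmx (X + H') *m (H - H') *m invmx (X + H).
Proof.
move=> bH bH'; have -> : H - H' = (X + H) - (X + H') by rewrite opprD addrACA subrr add0r.
rewrite mulmxBr mulmxBl (mulmxK (posdef_unitmx (ball_posdef bH))).
by rewrite (mulVmx (posdef_unitmx (ball_posdef bH'))) mul1mx.
Qed.

Local Notation N i H := (nonlin (A i) (D i) (B i) V H (invmx (X + H))).

Lemma rhsE H : in_ball H -> rhs H = tQ - Q +
  (\sum_i ((B i) ^t* *m D i + (D i) ^t* *m B i) + \sum_i (D i) ^t* *m V *m D i
   + \sum_i N i H).
Proof.
move=> bH; rewrite /rhs -!big_split; congr (_ + _); apply: eq_bigr => i _ /=.
exact: nonlinE Vh erefl (ball_invl bH) (ball_invr bH).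
Qed.

Let hdQ : hermset (tQ - Q) := hermsetB (proj1 htQ) (proj1 hQ).

Let hsym : hermset (\sum_i ((B i) ^t* *m D i + (D i) ^t* *m B i)).
Proof. by apply: hermset_sum => i _; apply: hermset_symM. Qed.

Let hquad : hermset (\sum_i (D i) ^t* *m V *m D i).
Proof. by apply: hermset_sum => i _; apply: hermset_conj; rewrite hermsetE. Qed.

Lemma rhs_herm H : in_ball H -> hermset (rhs H).
Proof.
move=> bH; apply: hermsetD hdQ _; apply: hermset_sum => i _.
have hV : hermset V by rewrite hermsetE.
have hY := proj1 (posdef_inv (ball_posdef bH)).
exact: hermsetB (hermsetD (hermset_conj _ (proj1 bH)) (hermset_conj _ hY)) (hermset_conj _ hV).
Qed.

(** The summands of [nonlin] are not visibly self-adjoint; the sum is Hermitian as a difference of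
    Hermitian matrices. This is required because [Linv] is controlled only on those. *)
Lemma nonlin_herm H : in_ball H -> hermset (\sum_i N i H).
Proof.
move=> bH; have := hermsetB (hermsetB (rhs_herm bH) hdQ) (hermsetD hsym hquad).
by rewrite (rhsE bH) [X in hermset (X - _ - _)]addrC addrK [X in hermset (X - _)]addrC addrK.
Qed.

Local Notation dA i := (spnorm (D i)).
Let th := \sum_i spnorm (B i) ^+ 2.
Let S := \sum_i ((spnorm (A i) + dA i) * z + spnorm (B i)) * dA i.
Let eps := k * spnorm (tQ - Q) +
  \sum_i (opnorm setT (Pop B i) * dA i + z * k * dA i ^+ 2).

Definition step H := Linv B (rhs H).

Lemma step_herm H : in_ball H -> hermset (step H).
Proof. by move=> bH; exact: (Linv_herm hn hX hQ eqB) (rhs_herm bH). Qed.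

(** The term linear in [D i] is measured by the norm of [Pop B i] itself rather than by the norms of
    [Linv B] and [B i] separately, in accordance with [eps]. *)
Lemma spnorm_step H : in_ball H ->
  spnorm (step H) <= eps + k * (th * (s * y * s) + S * (s * y)).
Proof.
move=> bH; have hN := nonlin_herm bH.
have LD := LinvD hn hX hQ eqB.
rewrite /step (rhsE bH) (LD _ _ hdQ (hermsetD (hermsetD hsym hquad) hN)).
rewrite (LD _ _ (hermsetD hsym hquad) hN) (LD _ _ hsym hquad) addrA.
have h1 := spnorm_Linv hdQ.
have h2 : spnorm (Linv B (\sum_i ((B i) ^t* *m D i + (D i) ^t* *m B i))) <=
    \sum_i opnorm setT (Pop B i) * dA i.
  rewrite (Linv_sum hn hX hQ eqB) => [|i]; last exact: hermset_symM.
  by apply: le_trans (spnorm_sum _ _ _) _; apply: ler_sum => i _; exact: spnorm_Pop.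
have h3 : spnorm (Linv B (\sum_i (D i) ^t* *m V *m D i)) <= \sum_i z * k * dA i ^+ 2.
  apply: le_trans (spnorm_Linv hquad) _; rewrite -mulr_sumr (mulrC z) -mulrA mulr_sumr.
  apply: ler_wpM2l; first exact/ltW/opnorm_Linv_gt0.
  apply: le_trans (spnorm_sum _ _ _) _; apply: ler_sum => i _.
  have hD : spnorm ((D i) ^t*) <= dA i by rewrite spnorm_adj.
  apply: le_trans (spnormM_le (spnormM_le hD (lexx _)) (lexx _)) _.
  have comm (a b : R) : a * b * a = b * a ^+ 2 by ring.
  by rewrite comm.
have h4 : spnorm (Linv B (\sum_i N i H)) <= k * (th * (s * y * s) + S * (s * y)).
  apply: le_trans (spnorm_Linv hN) _; apply: ler_wpM2l; first exact/ltW/opnorm_Linv_gt0.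
  apply: le_trans (spnorm_sum _ _ _) _.
  rewrite /th /S !mulr_suml -big_split; apply: ler_sum => i _ /=.
  exact: nonlin_bound (proj2 bH) (ball_spnorm_inv bH).
have -> : eps = k * spnorm (tQ - Q) + (\sum_i opnorm setT (Pop B i) * dA i
  + \sum_i z * k * dA i ^+ 2) by rewrite /eps big_split.
exact: spnormD_le (spnormD_le h1 (spnormD_le h2 h3)) h4.
Qed.

Lemma step_lipschitz H H' : in_ball H -> in_ball H' ->
  spnorm (step H - step H') <=
  k * (th * ((1 + s * y) ^+ 2 - 1) + S * ((1 + s * y) * y)) * spnorm (H - H').
Proof.
move=> bH bH'.
have -> : step H - step H' = Linv B (\sum_i N i H - \sum_i N i H').
  have -> : \sum_i N i H - \sum_i N i H' = rhs H - rhs H'.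
    have group (a b c e f : 'M[C]_n) : a + (b + c + e) - (a + (b + c + f)) = e - f.
      by apply/matrixP => i j; rewrite !mxE; ring.
    by rewrite (rhsE bH) (rhsE bH') group.
  have hL W : hermset W -> Lop B (Linv B W) = W by exact: (LinvK hn hX hQ eqB).
  rewrite /step -[in RHS](hL _ (rhs_herm bH)) -[in RHS](hL _ (rhs_herm bH')) -LopB.
  by rewrite (LopK hn hX hQ eqB (hermsetB (step_herm bH) (step_herm bH'))).
apply: le_trans (spnorm_Linv (hermsetB (nonlin_herm bH) (nonlin_herm bH'))) _.
rewrite -mulrA; apply: ler_wpM2l; first exact/ltW/opnorm_Linv_gt0.
rewrite -sumrB /th /S !mulr_suml -big_split mulr_suml /=.
apply: le_trans (spnorm_sum _ _ _) _; apply: ler_sum => i _.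
exact: nonlin_lipschitz (proj2 bH) (ball_spnorm_inv bH) (proj2 bH') (ball_spnorm_inv bH')
  (ball_inv_sub bH bH').
Qed.

Variables (T : 'M[C]_n) (q : R).
Hypotheses (hT : posdef T) (q01 : 0 <= q < 1).
Hypothesis eqT : T - \sum_i (A i + D i) ^t* *m invmx T *m (A i + D i) = tQ.
Hypothesis step_ball : forall H, in_ball H -> spnorm (step H) <= s.
Hypothesis step_contract : forall H H', in_ball H -> in_ball H' ->
  spnorm (step H - step H') <= q * spnorm (H - H').

Let h j := iter j step 0.

Let ball_iter j : in_ball (h j).
Proof.
elim: j => [|j IH]; first by split; [exact: hermset0|rewrite spnorm0].
by split; [exact: step_herm IH|exact: step_ball IH].
Qed.

Let iter_diff j : spnorm (h j - h j.+1) <= q ^+ j * spnorm (h 0%N - h 1%N).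
Proof.
elim: j => [|j IH]; first by rewrite expr0 mul1r.
apply: le_trans (step_contract (ball_iter j) (ball_iter j.+1)) _.
by rewrite exprS -mulrA; apply: ler_wpM2l; [case/andP: q01|exact: IH].
Qed.

Lemma solution_in_ball : spnorm (T - X) <= s.
Proof.
have posn W : posdef W -> 0 < spnorm (invmx W) by exact: posdef_inv_gt0.
have y0 : 0 < y by rewrite divr_gt0 ?posn // subr_gt0.
(* These constants serve [T] and all iterates at once, uniformly in [j]: [c] bounds [tQ] from below,
   while [d] and [g] bound [T] and every [X + h j] from above and below. The added 1 makes [d]
   positive. *)
pose c := (spnorm (invmx tQ))^-1.
pose d := spnorm T + (spnorm X + s) + 1.
pose g := Num.min (spnorm (invmx T))^-1 y^-1.
have c0 : 0 < c by rewrite invr_gt0; exact: posn.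
have nT := spnorm_ge0 T; have nX := spnorm_ge0 X.
have d0 : 0 < d := ltr_wpDl (addr_ge0 nT (addr_ge0 nX s0)) ltr01.
have dr : spnorm T <= d := ler_wpDr ler01 (ler_wpDr (addr_ge0 nX s0) (lexx _)).
have dl : spnorm X + s <= d := ler_wpDr ler01 (ler_wpDl nT (lexx _)).
have g0 : 0 < g by rewrite lt_min !invr_gt0 y0 posn.
have lower W x : posdef W -> (spnorm (invmx W))^-1 * l2norm x ^+ 2 <= ip x (W *m x).
  by move=> hW; rewrite ler_pdivrMl ?posn //; exact: posdef_lower.
have upper W x : spnorm W <= d -> ip x (W *m x) <= d * l2norm x ^+ 2.
  move=> hW; apply: le_trans (ler_norm _) _; apply: le_trans (ip_le_spnorm W x) _.
  by apply: ler_wpM2r; [exact: sqr_ge0|exact: hW].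
have [P P0 LP] : exists2 P, 0 <= P & forall W, spnorm (Lop B W) <= P * spnorm W.
  exists (1 + \sum_i spnorm (B i) ^+ 2) => [|W]; last exact: spnorm_Lop.
  by apply: addr_ge0 => //; apply: sumr_ge0 => i _; exact: sqr_ge0.
pose K := P * spnorm (h 0%N - h 1%N).
have K0 : 0 <= K by rewrite mulr_ge0 ?spnorm_ge0.
apply/ler_addgt0Pr => e e0.
(* The first entry meets the smallness condition of [solution_stability]; the second brings its
   conclusion below [e]. *)
pose eta := Num.min (c * g / (2 * d)) (e * (c * g) / (2 * d ^+ 2)).
have cg : 0 < c * g by rewrite mulr_gt0.
have eta0 : 0 < eta by rewrite lt_min !divr_gt0 ?mulr_gt0 ?exprn_gt0.
have [j hj] := geometric_small q01 K0 eta0.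
have := ltW hj; rewrite le_min => /andP[j1 j2].
have hYd : spnorm (X + h j) <= d.
  apply: le_trans (spnormD_le (lexx _) (proj2 (ball_iter j))) _.
  exact: dl.
have Yg x : g * l2norm x ^+ 2 <= ip x ((X + h j) *m x).
  apply: le_trans (lower _ x (ball_posdef (ball_iter j))).
  apply: ler_wpM2r; first exact: sqr_ge0.
  rewrite ge_min; apply/orP; right; rewrite lef_pV2.
  - exact: ball_spnorm_inv (ball_iter j).
  - exact: y0.
  - exact: posn (ball_posdef (ball_iter j)).
have Tg x : g * l2norm x ^+ 2 <= ip x (T *m x).
  apply: le_trans (lower _ x hT); apply: ler_wpM2r; first exact: sqr_ge0.
  by rewrite ge_min lexx.
have resE : spnorm (Lop B (h j - h j.+1)) <= K * q ^+ j.
  apply: le_trans (LP _) _; rewrite /K -mulrA (mulrC _ (q ^+ j)).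
  exact: ler_wpM2l P0 _ _ (iter_diff j).
(* As [L (h j.+1) = rhs (h j)], the residual of the iterate is [L (h j - h j.+1)], which decays like
   [q ^+ j]. *)
have eqY : (X + h j) - \sum_i (A i + D i) ^t* *m invmx (X + h j) *m (A i + D i) =
    tQ + Lop B (h j - h j.+1).
  have LinvB := LinvK hn hX hQ eqB (rhs_herm (ball_iter j)).
  by rewrite LopB [Lop B (h j.+1)]LinvB Lop_sub_rhs [RHS]addrC subrK.
have stab := solution_stability hn hT (ball_posdef (ball_iter j)) eqT eqY c0 d0 g0
  (fun x => lower tQ x htQ) (fun x => upper T x dr) (fun x => upper _ x hYd) Tg Yg resE.
have : spnorm (X + h j - T) <= e.
  apply: le_trans (stab _) _.
    by rewrite mulrC -ler_pdivlMr ?mulr_gt0.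
  by rewrite ler_pdivrMr // mulrC -ler_pdivlMr ?mulr_gt0 ?exprn_gt0.
have -> : T - X = h j - (X + h j - T).
  by rewrite opprB addrCA opprD [- X - _]addrC addrA addrA addrK.
by move=> he; exact: spnormB_le (proj2 (ball_iter j)) he.
Qed.

End Perturbation.

Unset Implicit Arguments.

Theorem theorem4p3 (R : realType) (m n : nat) (hm : (0 < m)%N) (hn : (0 < n)%N)
    (A tA : 'I_m -> 'M[R[i]]_n) (Q tQ X tX : 'M[R[i]]_n)
    (hQ : posdef Q) (htQ : posdef tQ)
    (hX : posdef_solution A Q X) (htX : posdef_solution tA tQ tX) :
  let B := fun i => invmx X *m A i in
  let dA := fun i => spnorm (tA i - A i) in
  let dQ := spnorm (tQ - Q) in
  let l := (opnorm hermset (Linv B))^-1 in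
  let zeta := spnorm (invmx X) in
  let mu := fun i => spnorm (A i) in
  let nu := fun i => opnorm setT (Pop B i) in
  let theta_ := fun i => spnorm (B i) in
  let theta := \sum_i theta_ i ^+ 2 in
  let eps := l^-1 * dQ + \sum_i (nu i * dA i + zeta / l * dA i ^+ 2) in
  let sigma := zeta / l * \sum_i ((mu i + dA i) * zeta + theta_ i) * dA i in
  sigma < 1 ->
  eps < l * (1 - sigma) ^+ 2 /
        (zeta * (l + l * sigma + 2 * theta
                 + 2 * Num.sqrt ((l * sigma + theta) * (theta + l)))) ->
  spnorm (tX - X) <=
    2 * l * eps /
    (l * (1 + zeta * eps - sigma)
     + Num.sqrt (l ^+ 2 * (1 + zeta * eps - sigma) ^+ 2
                 - 4 * l * zeta * eps * (l + theta))).
Proof.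
move=> B dA dQ l zeta mu nu theta_ theta eps sigma hsigma heps.
have [pX eqX] := hX; have [pT eqT] := htX.
pose D i := tA i - A i; pose k := opnorm hermset (Linv B).
have tAE i : tA i = A i + D i by rewrite addrC subrK.
have eqTD : tX - \sum_i (A i + D i) ^t* *m invmx tX *m (A i + D i) = tQ.
  by rewrite -eqT; congr (_ - _); apply: eq_bigr => i _; rewrite tAE.
have k0 : 0 < k := opnorm_Linv_gt0 hn hQ pX eqX.
have lk : l^-1 = k := invrK k.
have l0 : 0 < l by rewrite invr_gt0.
have zeta0 : 0 < zeta := posdef_inv_gt0 hn pX.
pose S := \sum_i ((mu i + dA i) * zeta + theta_ i) * dA i.
have theta0 : 0 <= theta by apply: sumr_ge0 => i _; exact: sqr_ge0.
have S0 : 0 <= S.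
  apply: sumr_ge0 => i _; apply: mulr_ge0 (spnorm_ge0 _).
  apply: addr_ge0 (spnorm_ge0 _); apply: mulr_ge0 (spnorm_ge0 _).
  exact: addr_ge0 (spnorm_ge0 _) (spnorm_ge0 _).
have sigmaE : sigma = zeta * k * S by rewrite /sigma lk.
have sigma01 : 0 <= sigma < 1.
  by rewrite hsigma andbT sigmaE; apply: mulr_ge0 S0; rewrite mulr_ge0 // ltW.
have nu0 i : 0 <= nu i.
  have := le_trans (spnorm_ge0 _) (spnorm_Pop hn hQ pX eqX i 1%:M).
  by rewrite pmulr_lge0 ?spnorm1_gt0.
have epsE : eps = k * dQ + \sum_i (nu i * dA i + zeta * k * dA i ^+ 2).
  by rewrite /eps lk.
have eps0 : 0 <= eps.
  rewrite epsE; apply: addr_ge0; first exact: mulr_ge0 (ltW k0) (spnorm_ge0 _).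
  apply: sumr_ge0 => i _; apply: addr_ge0; first exact: mulr_ge0 (nu0 i) (spnorm_ge0 _).
  exact: mulr_ge0 (mulr_ge0 (ltW zeta0) (ltW k0)) (sqr_ge0 _).
have := majorant_root l0 zeta0 theta0 sigma01 eps0 heps; cbv zeta.
set s := _ / _ => -[s0 zs fixs contr].
have u0 : 0 < 1 - zeta * s by rewrite subr_gt0.
have u_neq0 : 1 - zeta * s != 0 by rewrite gt_eqF.
pose y := zeta / (1 - zeta * s).
(* The fixed-point equation of the majorant gives equality here, which is why the ball of radius [s]
   is mapped into itself. *)
have bound : eps + k * (theta * (s * y * s) + S * (s * y)) = s.
  by apply: etrans fixs; rewrite sigmaE -lk; exact: majorant_valueE u_neq0 (lt0r_neq0 l0).
pose q := k * (theta * ((1 + s * y) ^+ 2 - 1) + S * ((1 + s * y) * y)).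
have qE : q = sigma / (1 - zeta * s) ^+ 2 + theta / l * ((1 - zeta * s)^-1 ^+ 2 - 1).
  by rewrite sigmaE /q -lk; exact: majorant_slopeE u_neq0 (lt0r_neq0 l0).
have y0 : 0 <= y by rewrite divr_ge0 // ltW.
have r1 : 1 <= 1 + s * y by rewrite lerDl mulr_ge0.
have q01 : 0 <= q < 1.
  rewrite {2}qE contr andbT; apply: mulr_ge0 (ltW k0) _; apply: addr_ge0.
    by apply: mulr_ge0 theta0 _; rewrite subr_ge0 exprn_ege1.
  by apply: mulr_ge0 S0 _; apply: mulr_ge0 y0; apply: le_trans r1.
apply: (solution_in_ball hn hQ htQ pX eqX s0 zs pT q01 eqTD) => [H bH|H H' bH bH'].
  apply: le_trans (spnorm_step hn D hQ htQ pX eqX zs bH) _.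
  by rewrite le_eqVlt; apply/orP; left; apply/eqP; exact: etrans (congr1 (+%R^~ _) (esym epsE)) bound.
have st := step_lipschitz hn D hQ htQ pX eqX zs bH bH'. exact: st.
Qed.
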